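(* Let $\alpha>-2$ and let $u=u_{\beta_0}$. Then: (i) If $N=3$, there is $c>0$ such that, as $r\to\infty$, $$u(r)=a_1r+a_2+a_3r^{-1}+O(e^{-cr}),$$ where $a_1=-\frac{1}{8\pi}\int_{\mathbb{R}^3}|x|^\alpha e^{u}dx$, $a_2=\frac{1}{8\pi}\int_{\mathbb{R}^3}|x|^{1+\alpha}e^{u}dx$, $a_3=-\frac{1}{24\pi}\int_{\mathbb{R}^3}|x|^{2+\alpha}e^{u}dx$. (ii) If $N=4$, $$u(r)+(8+2\alpha)\ln r\to\frac{1}{8\pi^2}\int_{\mathbb{R}^4}e^{u}|x|^\alpha\ln|x|\,dx\quad\text{as }r\to\infty.$$ (iii) If $N\ge5$, $$u(r)+(4+\alpha)\ln r\to\ln\big[2(4+\alpha)(N-2)(N-4)\big]\quad\text{as }r\to\infty.$$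
   Context: Fix an integer $N\ge3$ and $\alpha>-2$. For $\beta\in\mathbb{R}$, $u_\beta$ denotes the radial function $u_\beta(x)=u_\beta(r)$, $r=|x|$, solving the initial value problem $\Delta^2u=|x|^\alpha e^u$ for $r\in[0,R_\beta)$, $u'(0)=u'''(0)=0$, $u(0)=0$, $\Delta u(0)=\beta$, where $\Delta u=u''+\frac{N-1}{r}u'$ is the radial Laplacian in $\mathbb{R}^N$ and $[0,R_\beta)$ is the maximal interval of existence. $u_\beta$ is called an entire solution if $R_\beta=\infty$. $\beta_0:=\sup\{\beta\in\mathbb{R}:R_\beta=\infty\}$; it is known that $\beta_0$ is a finite negative number and that $R_\beta=\infty$ if and only if $\beta\le\beta_0$. *)

(* Defs.v *)
From Stdlib Require Import Reals.
From Coquelicot Require Import Coquelicot.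
Open Scope R_scope.

(* t^a for t > 0, extended by 0 at t <= 0 (only used with exponent > 0
   at t = 0, where this is the continuous extension). *)
Definition pw (t a : R) : R := if Rle_dec t 0 then 0 else Rpower t a.

(* (u, v) is a radial solution on [0, Rmax) of
      Delta^2 u = |x|^alpha e^u  in R^N,   v = Delta u,
   with u(0) = 0, Delta u(0) = beta, u'(0) = u'''(0) = 0,
   written in the standard radial form
      (r^{N-1} u')' = r^{N-1} v,   (r^{N-1} v')' = r^{N-1+alpha} e^u,
   i.e. for 0 < r < Rmax
      u'(r) = r^{1-N} \int_0^r t^{N-1} v(t) dt,
      v'(r) = r^{1-N} \int_0^r t^{N-1+alpha} e^{u(t)} dt,
   (the vanishing of the boundary terms at 0 encodes u'(0) = u'''(0) = 0),
   with u, v right-continuous at 0 with values 0 and beta. *)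
Definition radial_sol (N : nat) (alpha beta : R) (Rmax : Rbar)
    (u v : R -> R) : Prop :=
  u 0 = 0 /\ v 0 = beta /\
  filterlim u (at_right 0) (locally 0) /\
  filterlim v (at_right 0) (locally beta) /\
  (forall r, 0 < r -> Rbar_lt (Finite r) Rmax ->
     is_derive u r (pw r (1 - INR N) *
                    RInt (fun t => t ^ (N - 1) * v t) 0 r)) /\
  (forall r, 0 < r -> Rbar_lt (Finite r) Rmax ->
     is_derive v r (pw r (1 - INR N) *
                    RInt (fun t => pw t (INR N - 1 + alpha) * exp (u t)) 0 r)).

Definition entire (N : nat) (alpha beta : R) : Prop :=
  exists u v, radial_sol N alpha beta p_infty u v.

(* Integral over R^N of a radial function f(|x|), written in polar
   coordinates: |S^{N-1}| * \int_0^oo f(r) r^{N-1} dr  (improper integral).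
   Only used for N = 3 (|S^2| = 4 pi) and N = 4 (|S^3| = 2 pi^2). *)
Definition is_radial_integral3 (f : R -> R) (I : R) : Prop :=
  exists J, is_RInt_gen (fun r => f r * r ^ 2) (at_point 0) (Rbar_locally p_infty) J
            /\ I = 4 * PI * J.
Definition is_radial_integral4 (f : R -> R) (I : R) : Prop :=
  exists J, is_RInt_gen (fun r => f r * r ^ 3) (at_point 0) (Rbar_locally p_infty) J
            /\ I = 2 * PI ^ 2 * J.

(* Main.v *)
Require Import Defs.
From Stdlib Require Import Reals Lra Lia.
From Coquelicot Require Import Coquelicot.
Open Scope R_scope.

(** Write [v = Delta u]. It is increasing, and it cannot become positive: otherwise
    [u] grows at least linearly and [u(a+h) >= u(a) + c h^4 e^{u(a)}] forces blow-up
    in finite time. If [lim v < 0], then [u <= - d r^2] and a Picard iteration,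
    contractive for a weight built from [r^(3+alpha) e^u], yields an entire solution
    with a larger [beta]. Hence [v] tends to [0] for the critical [beta0].

    The monotonicity of [u], [v] and [r^(N-1) v'] then gives
    [- u' >= c r^(3+alpha) e^u], so that [r^(4+alpha) e^u] is bounded. In the
    variable [t = ln r] the function [w = u + (4+alpha) t] solves an autonomous
    fourth order equation whose energy is nondecreasing. For [N >= 5] this bounds
    [w] below and, by Barbalat's argument, drives [w] to the equilibrium. For
    [N = 4] the energy is conserved, which determines the mass
    [lim r^3 v' = 8 (4+alpha)]. For [N = 3], [r u] is a Taylor polynomial plus an
    integral remainder, and [u' <= - c] makes all tails exponentially small. *)

(** * Real powers *)

(** Criticality of [beta0] can only be exploited by exhibiting an entire solution with a larger
    [beta], so the Picard iteration has to run on the whole half-line at once. It starts at [u], a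
    subsolution for the larger value; the Gaussian decay of e^u makes the contraction weight
    comparable to r^2 everywhere, so a small shift keeps all iterates in a tube around [u].

    The split into dimensions comes from the energy identity: its right-hand side is a sum of
    squares of w' and w'' whose coefficients both contain the factor n - 4. They are positive for n
    >= 5, zero for n = 4 and negative for n = 3. In dimension three the radial Green function is
    polynomial up to a factor 1/r, which gives an explicit formula instead.

    For -2 < alpha <= -1 the weight r^(1+alpha) is unbounded or discontinuous at 0, and u', v' carry
    the factor r^(1-n). Hence all comparison principles below ask for continuity at 0 but for
    derivatives only at r > 0. *)

Lemma pw_eq t a : 0 < t -> pw t a = Rpower t a.
Proof. intros H. unfold pw. destruct (Rle_dec t 0); [lra | reflexivity]. Qed.

Lemma pw_nonpos t a : t <= 0 -> pw t a = 0.
Proof. intros H. unfold pw. destruct (Rle_dec t 0); [reflexivity | lra]. Qed.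

Lemma pw_gt0 t a : 0 < t -> 0 < pw t a.
Proof. intros H. rewrite pw_eq by assumption. apply exp_pos. Qed.

Lemma pw_ge0 t a : 0 <= pw t a.
Proof.
  destruct (Rle_dec t 0) as [H|H].
  - rewrite pw_nonpos by assumption; lra.
  - left; apply pw_gt0; lra.
Qed.

Lemma pw_add t a b : 0 < t -> pw t a * pw t b = pw t (a + b).
Proof. intros H. rewrite !pw_eq by assumption. now rewrite Rpower_plus. Qed.

Lemma pw_one t : 0 < t -> pw t 1 = t.
Proof. intros H. rewrite pw_eq by assumption. now apply Rpower_1. Qed.

Lemma pw_zero t : 0 < t -> pw t 0 = 1.
Proof. intros H. rewrite pw_eq by assumption. now apply Rpower_O. Qed.

Lemma pw_nat t k : 0 < t -> pw t (INR k) = t ^ k.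
Proof. intros H. rewrite pw_eq by assumption. now apply Rpower_pow. Qed.

Lemma pw_two t : 0 < t -> pw t 2 = t ^ 2.
Proof.
  intros H. rewrite <- pw_nat by assumption. reflexivity.
Qed.

Lemma pw_inv t a : 0 < t -> pw t (- a) = / pw t a.
Proof. intros H. rewrite !pw_eq by assumption. apply Rpower_Ropp. Qed.

Lemma pw_pw t a b : 0 < t -> pw (pw t a) b = pw t (a * b).
Proof.
  intros H. rewrite pw_eq by now apply pw_gt0.
  rewrite !pw_eq by assumption. apply Rpower_mult.
Qed.

Lemma pw_le t s a : 0 <= a -> 0 < t -> t <= s -> pw t a <= pw s a.
Proof. intros. rewrite !pw_eq by lra. apply Rle_Rpower_l; lra. Qed.

Lemma pw_ge1 t a : 1 <= t -> 0 <= a -> 1 <= pw t a.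
Proof.
  intros Ht Ha. rewrite pw_eq, <- (Rpower_O t) by lra. apply Rle_Rpower; lra.
Qed.

Lemma pw_mul_1 t a b : 0 < t -> a + b = 0 -> pw t a * pw t b = 1.
Proof. intros Ht E. rewrite pw_add, E by assumption. now apply pw_zero. Qed.

Lemma pw_exp t a : pw (exp t) a = exp (a * t).
Proof.
  rewrite pw_eq by apply exp_pos. unfold Rpower. now rewrite ln_exp.
Qed.

Lemma is_derive_pw a r :
  0 < r -> is_derive (fun t => pw t a) r (a * pw r (a - 1)).
Proof.
  intros H.
  apply is_derive_ext_loc with (fun t => Rpower t a).
  - exists (mkposreal r H). intros y Hy.
    unfold ball in Hy; simpl in Hy; unfold AbsRing_ball, abs, minus, plus, opp in Hy;
      simpl in Hy.
    apply Rabs_def2 in Hy. symmetry; apply pw_eq; lra.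
  - rewrite pw_eq by assumption.
    apply is_derive_Reals. now apply derivable_pt_lim_power.
Qed.

Lemma continuous_pw a x : 0 < a -> continuous (fun t => pw t a) x.
Proof.
  intros Ha.
  destruct (Rtotal_order x 0) as [H|[H|H]].
  - apply continuous_ext_loc with (fun _ => 0); [ | apply continuous_const].
    assert (Hx : 0 < - x) by lra.
    exists (mkposreal _ Hx). intros y Hy.
    unfold ball in Hy; simpl in Hy; unfold AbsRing_ball, abs, minus, plus, opp in Hy;
      simpl in Hy.
    apply Rabs_def2 in Hy. symmetry; apply pw_nonpos; lra.
  - subst x. apply filterlim_locally. intros eps.
    assert (Hd : 0 < Rpower eps (/ a)) by apply exp_pos.
    exists (mkposreal _ Hd). intros y Hy.
    unfold ball in *; simpl in *; unfold AbsRing_ball, abs, minus, plus, opp in *;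
      simpl in *.
    rewrite (pw_nonpos 0) by lra.
    rewrite Ropp_0, Rplus_0_r in *.
    rewrite Rabs_pos_eq by apply pw_ge0.
    destruct (Rle_dec y 0) as [Hy0|Hy0].
    + rewrite pw_nonpos by assumption. apply cond_pos.
    + rewrite pw_eq by lra. apply Rabs_def2 in Hy.
      replace (pos eps) with (Rpower (Rpower eps (/ a)) a).
      * apply Rlt_Rpower_l; lra.
      * rewrite Rpower_mult. replace (/ a * a) with 1 by (field; lra).
        apply Rpower_1, cond_pos.
  - apply (ex_derive_continuous (fun t => pw t a)).
    eexists. now apply is_derive_pw.
Qed.

Lemma exp_le_exp x y : x <= y -> exp x <= exp y.
Proof. intros [H| ->]; [left; now apply exp_increasing | lra]. Qed.

Lemma ln_le_sub1 x : 0 < x -> ln x <= x - 1.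
Proof.
  intros H. pose proof (exp_ineq1_le (ln x)) as E. rewrite exp_ln in E; lra.
Qed.

(** Apply ln x <= x - 1 at x = b r / k with k > |a|: this gives k ln r <= b r + k ln (k / b). It
    lets a power weight be absorbed at the cost of part of an exponential rate. *)
Lemma pw_le_exp a b : 0 < b ->
  exists C, 0 < C /\ forall r, 1 <= r -> pw r a <= C * exp (b * r).
Proof.
  intros Hb. set (k := Rabs a + 1).
  assert (Hk : 0 < k) by (unfold k; pose proof (Rabs_pos a); lra).
  exists (exp (k * ln (k / b))). split; [apply exp_pos|].
  intros r Hr. rewrite pw_eq by lra. unfold Rpower.
  rewrite <- exp_plus. apply exp_le_exp.
  assert (Hkb : 0 < k / b) by (apply Rdiv_lt_0_compat; lra).
  assert (Hq : 0 < b * r / k) by (apply Rdiv_lt_0_compat; nra).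
  assert (E : ln r = ln (b * r / k) + ln (k / b)).
  { rewrite <- ln_mult by assumption. f_equal. field; lra. }
  assert (H0 : 0 <= ln r) by (rewrite <- ln_1; apply ln_le; lra).
  pose proof (ln_le_sub1 _ Hq) as L.
  assert (a * ln r <= k * ln r).
  { apply Rmult_le_compat_r; [assumption|]. unfold k. pose proof (Rle_abs a); lra. }
  assert (k * ln (b * r / k) <= k * (b * r / k)) by (apply Rmult_le_compat_l; lra).
  replace (k * (b * r / k)) with (b * r) in * by (field; lra).
  rewrite E in H at 2. lra.
Qed.

(** * Functions continuous on the half-line *)

(* Only the values on [0, oo) matter: negative arguments are clipped to 0. *)
Definition hcont (f : R -> R) := forall x, continuous (fun t => f (Rmax 0 t)) x.

Lemma ball_R (x y e : R) : ball x e y <-> Rabs (y - x) < e.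
Proof. reflexivity. Qed.

Lemma locally_pos r : 0 < r -> locally r (fun t => 0 < t).
Proof. intros H. apply (open_gt 0 r H). Qed.

Lemma hcont_continuous f r : hcont f -> 0 < r -> continuous f r.
Proof.
  intros Hf H. apply continuous_ext_loc with (2 := Hf r).
  apply filter_imp with (2 := locally_pos r H).
  intros t Ht. now rewrite Rmax_right by lra.
Qed.

Lemma hcont_right f : hcont f -> filterlim f (at_right 0) (locally (f 0)).
Proof.
  intros Hf. specialize (Hf 0). unfold continuous in Hf.
  rewrite (Rmax_left 0 0) in Hf by lra.
  apply filterlim_locally. intros eps.
  destruct (proj1 (filterlim_locally _ _) Hf eps) as [d Hd].
  exists d. intros y Hy Hy0. specialize (Hd y Hy).
  now rewrite Rmax_right in Hd by lra.
Qed.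

Lemma hcont_intro f :
  (forall r, 0 < r -> continuous f r) ->
  filterlim f (at_right 0) (locally (f 0)) -> hcont f.
Proof.
  intros Hc H0 x. destruct (Rtotal_order x 0) as [H|[H|H]].
  - apply continuous_ext_loc with (fun _ => f 0); [ | apply continuous_const].
    apply filter_imp with (2 := open_lt 0 x H).
    intros t Ht. now rewrite Rmax_left by lra.
  - subst x. unfold continuous. rewrite (Rmax_left 0 0) by lra.
    apply filterlim_locally. intros eps.
    destruct (proj1 (filterlim_locally _ _) H0 eps) as [d Hd].
    exists d. intros y Hy. destruct (Rle_lt_dec y 0) as [Hy0|Hy0].
    + rewrite Rmax_left by lra. apply ball_center.
    + rewrite Rmax_right by lra. now apply Hd.
  - apply continuous_ext_loc with f; [ | now apply Hc].
    apply filter_imp with (2 := locally_pos x H).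
    intros t Ht. now rewrite Rmax_right by lra.
Qed.

Lemma continuous_hcont f : (forall x, continuous f x) -> hcont f.
Proof.
  intros Hf. apply hcont_intro; [intros; apply Hf|].
  apply filterlim_filter_le_1 with (2 := Hf 0). apply filter_le_within.
Qed.

Lemma hcont_const c : hcont (fun _ => c).
Proof. intros x; apply continuous_const. Qed.

Lemma hcont_id : hcont (fun t => t).
Proof. apply continuous_hcont; intros; apply continuous_id. Qed.

Lemma hcont_pw a : 0 < a -> hcont (fun t => pw t a).
Proof. intros; apply continuous_hcont; intros; now apply continuous_pw. Qed.

Lemma hcont_plus f g : hcont f -> hcont g -> hcont (fun t => f t + g t).
Proof. intros Hf Hg x. exact (continuous_plus _ _ _ (Hf x) (Hg x)). Qed.

Lemma hcont_opp f : hcont f -> hcont (fun t => - f t).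
Proof. intros Hf x. exact (continuous_opp _ _ (Hf x)). Qed.

Lemma hcont_minus f g : hcont f -> hcont g -> hcont (fun t => f t - g t).
Proof. intros Hf Hg x. exact (continuous_minus _ _ _ (Hf x) (Hg x)). Qed.

Lemma hcont_mult f g : hcont f -> hcont g -> hcont (fun t => f t * g t).
Proof. intros Hf Hg x. exact (continuous_mult _ _ _ (Hf x) (Hg x)). Qed.

Lemma hcont_pow f k : hcont f -> hcont (fun t => f t ^ k).
Proof.
  intros Hf; induction k as [|k IH]; simpl; [apply hcont_const|].
  now apply hcont_mult.
Qed.

Lemma hcont_exp f : hcont f -> hcont (fun t => exp (f t)).
Proof.
  intros Hf x. apply (continuous_comp (fun t => f (Rmax 0 t)) exp); [apply Hf|].
  apply (ex_derive_continuous exp). eexists. apply is_derive_exp.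
Qed.

Ltac hcont_tac := repeat first [ assumption |
  lazymatch goal with
  | |- hcont (fun _ => ?c) => apply (hcont_const c)
  | |- hcont (fun t => t) => apply hcont_id
  | |- hcont (fun t => @?f t + @?g t) => apply (hcont_plus f g)
  | |- hcont (fun t => @?f t - @?g t) => apply (hcont_minus f g)
  | |- hcont (fun t => @?f t * @?g t) => apply (hcont_mult f g)
  | |- hcont (fun t => - @?f t) => apply (hcont_opp f)
  | |- hcont (fun t => exp (@?f t)) => apply (hcont_exp f)
  | |- hcont (fun t => @?f t ^ ?k) => apply (hcont_pow f k)
  | |- hcont (fun t => pw t ?a) => apply (hcont_pw a); try lra
  | |- hcont (fun t => ?f t) => change (hcont f)
  end ].

Lemma hcont_bound f : hcont f ->
  exists C, 0 <= C /\ forall r, 0 <= r <= 1 -> Rabs (f r) <= C.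
Proof.
  intros Hf.
  destruct (continuity_ab_maj (fun t => Rabs (f (Rmax 0 t))) 0 1) as [m [Hm _]].
  - lra.
  - intros c _. apply continuity_pt_filterlim.
    exact (continuous_comp (fun t => f (Rmax 0 t)) Rabs c (Hf c) (continuous_Rabs _)).
  - exists (Rabs (f (Rmax 0 m))). split; [apply Rabs_pos|].
    intros r Hr. specialize (Hm r Hr). now rewrite (Rmax_right 0 r) in Hm by lra.
Qed.

(** For products of a factor singular at 0, such as a negative power or [ln], with a factor
    vanishing there: [hcont_mult] cannot treat them, a power bound near 0 can. *)
Lemma hcont_squeeze f C a : 0 < a -> f 0 = 0 ->
  (forall r, 0 < r -> continuous f r) ->
  (forall r, 0 < r < 1 -> Rabs (f r) <= C * pw r a) -> hcont f.
Proof.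
  intros Ha f0 Hc Hb. apply hcont_intro; [assumption|]. rewrite f0.
  assert (L : filterlim (fun r => C * pw r a) (at_right 0) (locally 0)).
  { replace 0 with (C * pw 0 a) at 2 by (rewrite pw_nonpos; lra).
    apply (hcont_right (fun r => C * pw r a)). hcont_tac. }
  apply filterlim_locally. intros eps.
  destruct (proj1 (filterlim_locally _ _) L eps) as [d Hd].
  assert (Hm : 0 < Rmin d 1) by (apply Rmin_pos; [apply cond_pos | lra]).
  exists (mkposreal _ Hm). intros y Hy Hy0.
  rewrite ball_R in Hy. simpl in Hy.
  assert (Rabs (y - 0) < d) by (eapply Rlt_le_trans; [apply Hy | apply Rmin_l]).
  assert (Y1 : Rabs (y - 0) < 1) by (eapply Rlt_le_trans; [apply Hy | apply Rmin_r]).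
  specialize (Hd y H Hy0). rewrite ball_R in *.
  rewrite Rminus_0_r in *. apply Rabs_def2 in Y1.
  assert (Hy1 : 0 < y < 1) by lra. specialize (Hb y Hy1).
  eapply Rle_lt_trans; [apply Hb|]. eapply Rle_lt_trans; [apply Rle_abs | apply Hd].
Qed.

(** * Derivative rules for real functions *)

Lemma D_eq (f : R -> R) (x a b : R) : is_derive f x a -> a = b -> is_derive f x b.
Proof. now intros H <-. Qed.

Lemma D_const (c x : R) : is_derive (fun _ : R => c) x 0.
Proof. exact (is_derive_const c x). Qed.

Lemma D_id (x : R) : is_derive (fun t : R => t) x 1.
Proof. exact (is_derive_id x). Qed.

Lemma D_plus (f g : R -> R) (x a b : R) : is_derive f x a -> is_derive g x b ->
  is_derive (fun t => f t + g t) x (a + b).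
Proof. exact (is_derive_plus f g x a b). Qed.

Lemma D_minus (f g : R -> R) (x a b : R) : is_derive f x a -> is_derive g x b ->
  is_derive (fun t => f t - g t) x (a - b).
Proof. exact (is_derive_minus f g x a b). Qed.

Lemma D_opp (f : R -> R) (x a : R) : is_derive f x a ->
  is_derive (fun t => - f t) x (- a).
Proof. exact (is_derive_opp f x a). Qed.

Lemma D_mult (f g : R -> R) (x a b : R) : is_derive f x a -> is_derive g x b ->
  is_derive (fun t => f t * g t) x (a * g x + f x * b).
Proof. intros Hf Hg. exact (is_derive_mult f g x a b Hf Hg Rmult_comm). Qed.

Lemma D_comp (f g : R -> R) (x a b : R) : is_derive f (g x) a -> is_derive g x b ->
  is_derive (fun t => f (g t)) x (b * a).
Proof. exact (is_derive_comp f g x a b). Qed.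

Lemma D_exp (f : R -> R) (x a : R) : is_derive f x a ->
  is_derive (fun t => exp (f t)) x (a * exp (f x)).
Proof. intros. apply D_comp; [apply is_derive_exp | assumption]. Qed.

Lemma D_pow (f : R -> R) (k : nat) (x a : R) : is_derive f x a ->
  is_derive (fun t => f t ^ k) x (INR k * a * f x ^ pred k).
Proof. apply is_derive_pow. Qed.

Lemma D_ext_half (f g : R -> R) (x a : R) : 0 < x ->
  (forall t, 0 < t -> f t = g t) -> is_derive f x a -> is_derive g x a.
Proof.
  intros Hx E. apply is_derive_ext_loc.
  apply filter_imp with (2 := locally_pos x Hx). exact E.
Qed.

(* [D] leaves the equation between the computed and the stated derivative. *)
Ltac D := eapply D_eq;
  [ repeat first [ solve [ eauto ] |
    lazymatch goal with
    | |- is_derive (fun _ => ?c) _ _ => apply (D_const c)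
    | |- is_derive (fun t => t) _ _ => apply D_id
    | |- is_derive (fun t => @?f t + @?g t) _ _ => apply (D_plus f g)
    | |- is_derive (fun t => @?f t - @?g t) _ _ => apply (D_minus f g)
    | |- is_derive (fun t => @?f t * @?g t) _ _ => apply (D_mult f g)
    | |- is_derive (fun t => - @?f t) _ _ => apply (D_opp f)
    | |- is_derive (fun t => exp (@?f t)) _ _ => apply (D_exp f)
    | |- is_derive (fun t => @?f t ^ ?k) _ _ => apply (D_pow f k)
    | |- is_derive (fun t => pw t ?a) _ _ => apply (is_derive_pw a); lra
    | |- is_derive (fun t => ?f t) ?x ?l => change (is_derive f x l)
    end ]
  | cbv beta ].

(** * Comparison through derivatives *)

Lemma incr_pos F dF a b : a <= b ->
  (forall x, a <= x <= b -> is_derive F x (dF x)) ->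
  (forall x, a <= x <= b -> 0 <= dF x) -> F a <= F b.
Proof.
  intros Hab HD Hp.
  destruct (MVT_gen F a b dF) as [c [Hc E]].
  - intros x Hx. rewrite Rmin_left, Rmax_right in Hx by lra. apply HD; lra.
  - intros x Hx. rewrite Rmin_left, Rmax_right in Hx by lra.
    apply continuity_pt_filterlim, (ex_derive_continuous F).
    eexists; apply HD; lra.
  - rewrite Rmin_left, Rmax_right in Hc by lra. specialize (Hp c Hc). nra.
Qed.

Lemma le_pos F G dF dG a b : a <= b -> F a <= G a ->
  (forall x, a <= x <= b -> is_derive F x (dF x)) ->
  (forall x, a <= x <= b -> is_derive G x (dG x)) ->
  (forall x, a <= x <= b -> dF x <= dG x) -> F b <= G b.
Proof.
  intros Hab H0 HF HG Hl.
  assert (G a - F a <= G b - F b); [|lra].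
  apply (incr_pos (fun x => G x - F x) (fun x => dG x - dF x)); [assumption| |].
  - intros x Hx. exact (is_derive_minus _ _ _ _ _ (HG x Hx) (HF x Hx)).
  - intros x Hx. specialize (Hl x Hx). lra.
Qed.

(** Monotonicity from the origin when nothing is known about a derivative at 0; [F] is extended to
    the left by its value at 0. *)
Lemma incr_half F dF b : 0 <= b -> hcont F ->
  (forall x, 0 < x <= b -> is_derive F x (dF x)) ->
  (forall x, 0 < x <= b -> 0 <= dF x) -> F 0 <= F b.
Proof.
  intros Hb Hc HD Hp. destruct Hb as [Hb| <-]; [|lra].
  (* The mean value point may be the endpoint 0, where [dF] is unconstrained; the clipped derivative
     is nonnegative there too and equals [dF] in the interior. *)
  destruct (MVT_gen (fun t => F (Rmax 0 t)) 0 b (fun x => Rmax 0 (dF x)))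
    as [c [Hc' E]].
  - intros x Hx. rewrite Rmin_left, Rmax_right in Hx by lra.
    rewrite (Rmax_right 0 (dF x)) by (apply Hp; lra).
    apply is_derive_ext_loc with F; [|apply HD; lra].
    apply filter_imp with (2 := locally_pos x (proj1 Hx)).
    intros t Ht. now rewrite Rmax_right by lra.
  - intros x _. apply continuity_pt_filterlim, Hc.
  - rewrite (Rmax_left 0 0), (Rmax_right 0 b) in E by lra.
    pose proof (Rmax_l 0 (dF c)). nra.
Qed.

(** Main device for the pointwise bounds: guess a closed form for the bound, then compare values at
    0 and derivatives. *)
Lemma le_half F G dF dG b : 0 <= b -> F 0 <= G 0 -> hcont F -> hcont G ->
  (forall x, 0 < x <= b -> is_derive F x (dF x)) ->
  (forall x, 0 < x <= b -> is_derive G x (dG x)) ->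
  (forall x, 0 < x <= b -> dF x <= dG x) -> F b <= G b.
Proof.
  intros Hb H0 cF cG HF HG Hl.
  assert (G 0 - F 0 <= G b - F b); [|lra].
  apply (incr_half (fun x => G x - F x) (fun x => dG x - dF x)); [assumption| | |].
  - now apply hcont_minus.
  - intros x Hx. exact (is_derive_minus _ _ _ _ _ (HG x Hx) (HF x Hx)).
  - intros x Hx. specialize (Hl x Hx). lra.
Qed.

Lemma eq_half F G dF b : 0 <= b -> F 0 = G 0 -> hcont F -> hcont G ->
  (forall x, 0 < x <= b -> is_derive F x (dF x)) ->
  (forall x, 0 < x <= b -> is_derive G x (dF x)) -> F b = G b.
Proof.
  intros Hb H0 cF cG HF HG.
  apply Rle_antisym; apply (le_half _ _ dF dF); auto; intros; lra.
Qed.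

Lemma hcont_RInt f r : hcont f -> 0 <= r ->
  is_RInt f 0 r (RInt (fun t => f (Rmax 0 t)) 0 r).
Proof.
  intros Hf Hr. apply is_RInt_ext with (fun t => f (Rmax 0 t)).
  - intros x Hx. rewrite Rmin_left in Hx by lra. now rewrite Rmax_right by lra.
  - apply (RInt_correct (fun t => f (Rmax 0 t))).
    apply (ex_RInt_continuous (fun t => f (Rmax 0 t))). intros; apply Hf.
Qed.

Lemma continuous_is_derive_RInt (g : R -> R) (x : R) : (forall t, continuous g t) ->
  is_derive (fun b => RInt g 0 b) x (g x).
Proof.
  intros Hg. apply (is_derive_RInt g _ 0); [|apply Hg].
  apply filter_forall. intros b. apply (RInt_correct g).
  apply (ex_RInt_continuous g). intros; apply Hg.
Qed.

Lemma FTC_half F f : hcont F -> hcont f ->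
  (forall r, 0 < r -> is_derive F r (f r)) ->
  forall r, 0 <= r -> is_RInt f 0 r (F r - F 0).
Proof.
  intros cF cf HF r Hr.
  pose proof (hcont_RInt f r cf Hr) as H.
  replace (F r - F 0) with (RInt (fun t => f (Rmax 0 t)) 0 r); [exact H|].
  apply (eq_half (fun b => RInt (fun t => f (Rmax 0 t)) 0 b)
                 (fun b => F b - F 0) f); auto.
  - rewrite (RInt_point 0 (fun t => f (Rmax 0 t))). change (0 = F 0 - F 0). ring.
  - apply continuous_hcont. intros x.
    apply (ex_derive_continuous (fun b => RInt (fun t => f (Rmax 0 t)) 0 b)).
    eexists. apply (continuous_is_derive_RInt (fun t => f (Rmax 0 t))), cf.
  - apply hcont_minus; [assumption | apply hcont_const].
  - intros x Hx.
    pose proof (continuous_is_derive_RInt (fun t => f (Rmax 0 t)) x cf) as D.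
    cbv beta in D. rewrite Rmax_right in D by lra. exact D.
  - intros x Hx. eapply D_eq; [apply D_minus; [apply HF; lra | apply D_const] | ring].
Qed.

(** * Primitives of [r^a f(r)] *)

(* The substitution [sigma = r^(a+1)] makes the integral proper even for
   [-1 < a < 0]. *)
Definition prim (a : R) (f : R -> R) (r : R) : R :=
  / (a + 1) * RInt (fun s => f (Rmax 0 (pw s (/ (a + 1))))) 0 (pw r (a + 1)).

Section Prim.
Variables (a : R) (f : R -> R).
Hypotheses (Ha : -1 < a) (Hf : hcont f).

Let continuous_integrand s : continuous (fun s => f (Rmax 0 (pw s (/ (a + 1))))) s.
Proof.
  apply (continuous_comp (fun s => pw s (/ (a + 1))) (fun t => f (Rmax 0 t)));
    [|apply Hf].
  apply continuous_pw. apply Rinv_0_lt_compat; lra.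
Qed.

Lemma prim_0 : prim a f 0 = 0.
Proof.
  unfold prim. rewrite pw_nonpos by lra. rewrite RInt_point.
  change (/ (a + 1) * 0 = 0). ring.
Qed.

Lemma hcont_prim : hcont (prim a f).
Proof.
  apply hcont_mult; [apply hcont_const|].
  apply continuous_hcont. intros x.
  apply (continuous_comp (fun r => pw r (a + 1))
    (fun b => RInt (fun s => f (Rmax 0 (pw s (/ (a + 1))))) 0 b)).
  - apply continuous_pw; lra.
  - apply (ex_derive_continuous
      (fun b => RInt (fun s => f (Rmax 0 (pw s (/ (a + 1))))) 0 b)).
    eexists. apply (continuous_is_derive_RInt _ _ continuous_integrand).
Qed.

Lemma is_derive_prim r : 0 < r -> is_derive (prim a f) r (pw r a * f r).
Proof.
  intros Hr. unfold prim.
  pose proof (continuous_is_derive_RInt _ (pw r (a + 1)) continuous_integrand) as D.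
  cbv beta in D. rewrite pw_pw in D by assumption.
  replace ((a + 1) * / (a + 1)) with 1 in D by (field; lra).
  rewrite pw_one, Rmax_right in D by lra.
  pose proof (is_derive_comp _ (fun r => pw r (a + 1)) r _ _ D
                (is_derive_pw (a + 1) r Hr)) as D2.
  apply (is_derive_scal _ _ (/ (a + 1))) in D2.
  replace (pw r a * f r) with
    (/ (a + 1) * scal ((a + 1) * pw r (a + 1 - 1)) (f r)); [exact D2|].
  unfold scal; simpl; unfold mult; simpl.
  replace (a + 1 - 1) with a by ring. field; lra.
Qed.

End Prim.

Opaque prim.

(** Connects [prim] with the integrals in [radial_sol], whose exponents N - 1 and N - 1 + alpha are
    positive. *)
Lemma RInt_prim a g r : 0 < a -> hcont g -> 0 <= r ->
  RInt (fun t => pw t a * g t) 0 r = prim a g r.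
Proof.
  intros Ha Hg Hr. apply is_RInt_unique.
  replace (prim a g r) with (prim a g r - prim a g 0) by (rewrite prim_0; ring).
  apply (FTC_half (prim a g)); auto.
  - apply hcont_prim; auto; lra.
  - hcont_tac.
  - intros; apply is_derive_prim; auto; lra.
Qed.

Lemma INR_pred N : (1 <= N)%nat -> INR (N - 1) = INR N - 1.
Proof. intros H. rewrite minus_INR by assumption. reflexivity. Qed.

Lemma RInt_prim_nat N g r : (2 <= N)%nat -> hcont g -> 0 <= r ->
  RInt (fun t => t ^ (N - 1) * g t) 0 r = prim (INR N - 1) g r.
Proof.
  intros HN Hg Hr. pose proof (le_INR _ _ HN) as H. simpl in H.
  rewrite <- RInt_prim by (auto; lra).
  apply RInt_ext. intros x Hx. rewrite Rmin_left in Hx by lra.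
  rewrite <- INR_pred by lia. now rewrite pw_nat by lra.
Qed.

Lemma prim_le a f g h c r : -1 < a -> hcont f -> hcont g -> hcont h -> 0 <= r ->
  (forall s, 0 < s <= r -> g s <= f s + c * h s) ->
  prim a g r <= prim a f r + c * prim a h r.
Proof.
  intros Ha Hf Hg Hh Hr Hl.
  apply (le_half _ (fun r => prim a f r + c * prim a h r)
           (fun r => pw r a * g r) (fun r => pw r a * f r + c * (pw r a * h r)));
    auto using hcont_prim.
  - rewrite !prim_0; lra.
  - hcont_tac; now apply hcont_prim.
  - intros x Hx; apply is_derive_prim; auto; lra.
  - intros x Hx. eapply D_eq.
    + apply D_plus; [|apply D_mult; [apply D_const|]];
        apply is_derive_prim; auto; lra.
    + cbv beta; ring.
  - intros x Hx. specialize (Hl x Hx). pose proof (pw_ge0 x a). nra.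
Qed.

Lemma prim_pos a f r : -1 < a -> hcont f -> 0 <= r ->
  (forall s, 0 < s <= r -> 0 <= f s) -> 0 <= prim a f r.
Proof.
  intros Ha Hf Hr Hp.
  rewrite <- (prim_0 a f). apply (incr_half _ (fun r => pw r a * f r)); auto.
  - now apply hcont_prim.
  - intros; apply is_derive_prim; auto; lra.
  - intros x Hx. apply Rmult_le_pos; [apply pw_ge0 | now apply Hp].
Qed.

Lemma prim_one a r : -1 < a -> 0 <= r -> prim a (fun _ => 1) r = pw r (a + 1) / (a + 1).
Proof.
  intros Ha Hr.
  apply (eq_half _ (fun r => pw r (a + 1) * / (a + 1)) (fun r => pw r a * 1)); auto.
  - rewrite prim_0, pw_nonpos by lra. ring.
  - apply hcont_prim; auto; apply hcont_const.
  - hcont_tac.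
  - intros; apply (is_derive_prim a (fun _ => 1)); auto; [apply hcont_const | lra].
  - intros x Hx. D. replace (a + 1 - 1) with a by ring. field; lra.
Qed.

Lemma prim_abs_le a f C r : -1 < a -> hcont f -> 0 <= r ->
  (forall s, 0 <= s <= r -> Rabs (f s) <= C) ->
  Rabs (prim a f r) <= C * (pw r (a + 1) / (a + 1)).
Proof.
  intros Ha Hf Hr Hb. rewrite <- prim_one by assumption.
  apply Rabs_le. split.
  - assert (0 <= prim a f r + C * prim a (fun _ => 1) r); [|lra].
    replace 0 with (prim a (fun _ => 0) r).
    + apply prim_le; auto using hcont_const. intros s Hs.
      assert (Hs' : 0 <= s <= r) by lra. specialize (Hb s Hs').
      apply Rabs_le_between in Hb. lra.
    + apply Rle_antisym.
      (* Comparison of the zero function with itself for c = -1 reads P <= P - P, that is P <= 0. *)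
      * assert (prim a (fun _ => 0) r <= prim a (fun _ => 0) r
                 + (-1) * prim a (fun _ => 0) r); [|].
        { apply prim_le; auto using hcont_const. intros; lra. }
        lra.
      * apply prim_pos; auto using hcont_const. intros; lra.
  - assert (prim a f r <= prim a (fun _ => 1) r + (C - 1) * prim a (fun _ => 1) r).
    { apply prim_le; auto using hcont_const. intros s Hs.
      assert (Hs' : 0 <= s <= r) by lra. specialize (Hb s Hs').
      apply Rabs_le_between in Hb. lra. }
    lra.
Qed.

(** * Inverse of the radial Laplacian *)

(* [invlap n g f] solves [Delta w = r^g f] in dimension [n] with [w(0) = 0]; it is
   [int_0^r t^(1-n) int_0^t s^(n-1+g) f(s) ds dt] with the order of integration
   exchanged. *)
Definition invlap (n g : R) (f : R -> R) (r : R) : R :=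
  / (n - 2) * (prim (1 + g) f r - pw r (2 - n) * prim (n - 1 + g) f r).

Lemma invlap_0 n g f : invlap n g f 0 = 0.
Proof. unfold invlap. rewrite !prim_0. ring. Qed.

(** The contributions of the two integrands cancel because r^(1+g) = r^(2-n) r^(n-1+g); only the
    derivative of r^(2-n) survives. *)
Lemma is_derive_invlap n g f r : 2 < n -> -2 < g -> hcont f -> 0 < r ->
  is_derive (invlap n g f) r (pw r (1 - n) * prim (n - 1 + g) f r).
Proof.
  intros Hn Hg Hf Hr. unfold invlap. eapply D_eq.
  - apply D_mult; [apply D_const|]. apply D_minus;
      [|apply D_mult; [now apply is_derive_pw|]];
      apply is_derive_prim; auto; lra.
  - cbv beta. replace (2 - n - 1) with (1 - n) by ring.
    replace (pw r (1 + g)) with (pw r (2 - n) * pw r (n - 1 + g));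
      [|rewrite pw_add by assumption; f_equal; ring].
    field; lra.
Qed.

(** Near 0 the second term is r^(2-n) times a quantity of order r^(n+g), hence of order r^(2+g), and
    2 + g > 0. *)
Lemma hcont_invlap n g f : 2 < n -> -2 < g -> hcont f -> hcont (invlap n g f).
Proof.
  intros Hn Hg Hf. unfold invlap.
  apply hcont_mult; [apply hcont_const|].
  apply hcont_minus; [apply hcont_prim; auto; lra|].
  destruct (hcont_bound f Hf) as [C [HC Hb]].
  apply (hcont_squeeze _ (C * / (n - 1 + g + 1)) (2 + g)); [lra| | |].
  - rewrite prim_0; ring.
  - intros r Hr. apply (continuous_mult (fun r => pw r (2 - n))).
    + apply (ex_derive_continuous (fun r => pw r (2 - n))).
      eexists; now apply is_derive_pw.
    + apply hcont_continuous; [apply hcont_prim; auto; lra | assumption].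
  - intros r Hr. rewrite Rabs_mult, Rabs_pos_eq by apply pw_ge0.
    eapply Rle_trans.
    + apply Rmult_le_compat_l; [apply pw_ge0|].
      apply prim_abs_le with (C := C); auto; try lra. intros; apply Hb; lra.
    + right. replace (2 + g) with (2 - n + (n - 1 + g + 1)) by ring.
      rewrite <- (pw_add r (2 - n)) by lra. field; lra.
Qed.

(** One form for two uses: c = 0 gives monotonicity, and c > 0 with [h] the linearised source gives
    the contraction estimate. *)
Lemma invlap_le n g f1 f2 h c r : 2 < n -> -2 < g ->
  hcont f1 -> hcont f2 -> hcont h -> 0 <= r ->
  (forall s, 0 < s <= r -> f2 s <= f1 s + c * h s) ->
  invlap n g f2 r <= invlap n g f1 r + c * invlap n g h r.
Proof.
  intros Hn Hg H1 H2 Hh Hr Hl.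
  apply (le_half _ (fun r => invlap n g f1 r + c * invlap n g h r)
           (fun r => pw r (1 - n) * prim (n - 1 + g) f2 r)
           (fun r => pw r (1 - n) * prim (n - 1 + g) f1 r
                     + c * (pw r (1 - n) * prim (n - 1 + g) h r)));
    auto using hcont_invlap.
  - rewrite !invlap_0; lra.
  - hcont_tac; now apply hcont_invlap.
  - intros x Hx; apply is_derive_invlap; auto; lra.
  - intros x Hx. eapply D_eq.
    + apply D_plus; [|apply D_mult; [apply D_const|]];
        apply is_derive_invlap; auto; lra.
    + cbv beta; ring.
  - intros x Hx.
    assert (prim (n - 1 + g) f2 x
            <= prim (n - 1 + g) f1 x + c * prim (n - 1 + g) h x).
    { apply prim_le; auto; try lra. intros; apply Hl; lra. }
    pose proof (pw_ge0 x (1 - n)). nra.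
Qed.

Lemma invlap_le_prim n g f r : 2 < n -> -2 < g -> hcont f -> 0 <= r ->
  (forall s, 0 < s <= r -> 0 <= f s) ->
  invlap n g f r <= / (n - 2) * prim (1 + g) f r.
Proof.
  intros Hn Hg Hf Hr Hp. unfold invlap.
  assert (0 <= prim (n - 1 + g) f r) by (apply prim_pos; auto; lra).
  assert (0 < / (n - 2)) by (apply Rinv_0_lt_compat; lra).
  pose proof (pw_ge0 r (2 - n)).
  apply Rmult_le_compat_l; [lra|]. nra.
Qed.

(** Keeps the formula available by rewriting after [invlap] is made opaque; dimension three computes
    with it. *)
Lemma invlap_def n g f r : invlap n g f r =
  / (n - 2) * (prim (1 + g) f r - pw r (2 - n) * prim (n - 1 + g) f r).
Proof. reflexivity. Qed.

Opaque invlap.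

Lemma invlap_const n c r : 2 < n -> 0 <= r -> invlap n 0 (fun _ => c) r = c * r ^ 2 / (2 * n).
Proof.
  intros Hn Hr.
  apply (eq_half _ (fun r => c * r ^ 2 * / (2 * n))
           (fun r => pw r (1 - n) * prim (n - 1 + 0) (fun _ => c) r)); auto.
  - rewrite invlap_0. ring.
  - apply hcont_invlap; auto using hcont_const; lra.
  - hcont_tac.
  - intros; apply is_derive_invlap; auto using hcont_const; lra.
  - intros x Hx.
    assert (E : prim (n - 1 + 0) (fun _ => c) x = c * (pw x n * / n)).
    { apply (eq_half _ (fun x => c * (pw x n * / n)) (fun r => pw r (n - 1 + 0) * c)).
      - lra.
      - rewrite prim_0, pw_nonpos by lra. ring.
      - apply hcont_prim; auto using hcont_const; lra.
      - hcont_tac.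
      - intros y Hy. apply (is_derive_prim _ (fun _ => c)); auto using hcont_const; lra.
      - intros y Hy. D. replace (n - 1 + 0) with (n - 1) by ring. field; lra. }
    rewrite E. D.
    replace (pw x (1 - n) * (c * (pw x n * / n)))
      with (pw x (1 - n) * pw x n * (c * / n)) by ring.
    rewrite pw_add by lra. replace (1 - n + n) with 1 by ring. rewrite pw_one by lra.
    simpl. field; lra.
Qed.

(** * The radial problem as a first order system *)

(* [A = r^(n-1) u'] and [B = r^(n-1) (Delta u)']. *)
Record rsys (n alpha beta : R) (u v A B : R -> R) : Prop := {
  rsys_u : hcont u; rsys_v : hcont v; rsys_A : hcont A; rsys_B : hcont B;
  rsys_u0 : u 0 = 0; rsys_v0 : v 0 = beta; rsys_A0 : A 0 = 0; rsys_B0 : B 0 = 0;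
  rsys_du : forall r, 0 < r -> is_derive u r (pw r (1 - n) * A r);
  rsys_dv : forall r, 0 < r -> is_derive v r (pw r (1 - n) * B r);
  rsys_dA : forall r, 0 < r -> is_derive A r (pw r (n - 1) * v r);
  rsys_dB : forall r, 0 < r -> is_derive B r (pw r (n - 1 + alpha) * exp (u r)) }.

Lemma radial_sol_rsys N alpha beta u v : (3 <= N)%nat -> -2 < alpha ->
  radial_sol N alpha beta p_infty u v ->
  rsys (INR N) alpha beta u v
    (prim (INR N - 1) v) (prim (INR N - 1 + alpha) (fun r => exp (u r))).
Proof.
  intros HN Ha [u0 [v0 [Lu [Lv [Du Dv]]]]].
  pose proof (le_INR _ _ HN) as HN'. simpl in HN'.
  assert (cu : hcont u).
  { apply hcont_intro; [|now rewrite u0].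
    intros r Hr. apply (ex_derive_continuous u). eexists; now apply Du. }
  assert (cv : hcont v).
  { apply hcont_intro; [|now rewrite v0].
    intros r Hr. apply (ex_derive_continuous v). eexists; now apply Dv. }
  assert (ce : hcont (fun r => exp (u r))) by now apply hcont_exp.
  constructor; auto.
  - apply hcont_prim; auto; lra.
  - apply hcont_prim; auto; lra.
  - apply prim_0.
  - apply prim_0.
  - intros r Hr. rewrite <- RInt_prim_nat by (auto; lia || lra). now apply Du.
  - intros r Hr.
    rewrite <- (RInt_prim _ (fun r => exp (u r))) by (auto; lra). now apply Dv.
  - intros r Hr. apply is_derive_prim; auto; lra.
  - intros r Hr. apply (is_derive_prim _ (fun r => exp (u r))); auto; lra.
Qed.

(** The integral equation contains the initial data and the differentiability, so a continuous fixed
    point on the half-line is enough to produce an entire solution. *)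
Lemma fixed_point_entire N alpha beta u : (3 <= N)%nat -> -2 < alpha -> hcont u ->
  (forall r, 0 <= r ->
     u r = invlap (INR N) 0 (fun s => beta + invlap (INR N) alpha (fun x => exp (u x)) s) r) ->
  entire N alpha beta.
Proof.
  intros HN Ha cu E.
  pose proof (le_INR _ _ HN) as HN'. simpl in HN'.
  set (v := fun s => beta + invlap (INR N) alpha (fun x => exp (u x)) s) in *.
  assert (ce : hcont (fun r => exp (u r))) by now apply hcont_exp.
  assert (cv : hcont v).
  { unfold v. apply hcont_plus; [apply hcont_const|]. apply hcont_invlap; auto; lra. }
  assert (u0 : u 0 = 0) by (rewrite E by lra; apply invlap_0).
  assert (v0 : v 0 = beta) by (unfold v; rewrite invlap_0; ring).
  exists u, v. split; [assumption|]. split; [assumption|].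
  split; [|split; [|split]].
  - rewrite <- u0 at 2. now apply hcont_right.
  - rewrite <- v0. now apply hcont_right.
  - intros r Hr _. rewrite RInt_prim_nat by (auto; lia || lra).
    apply (D_ext_half (invlap (INR N) 0 v)); auto.
    + intros t Ht. symmetry; apply E; lra.
    + replace (INR N - 1) with (INR N - 1 + 0) by ring. apply is_derive_invlap; auto; lra.
  - intros r Hr _. rewrite (RInt_prim _ (fun r => exp (u r))) by (auto; lra).
    unfold v. eapply D_eq.
    + apply D_plus; [apply D_const|]. apply is_derive_invlap; auto; lra.
    + ring.
Qed.

(** Each unknown agrees with its primitive since both have the same value at 0 and the same
    derivative; [A] and [B] come first because u' and v' are expressed through them. *)
Lemma rsys_fixed_point n alpha beta u v A B : 2 < n -> -2 < alpha ->
  rsys n alpha beta u v A B ->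
  forall r, 0 <= r -> v r = beta + invlap n alpha (fun x => exp (u x)) r /\ u r = invlap n 0 v r.
Proof.
  intros Hn Ha [cu cv cA cB u0 v0 A0 B0 du dv dA dB] r Hr.
  assert (ce : hcont (fun r => exp (u r))) by now apply hcont_exp.
  assert (EB : forall r, 0 <= r -> B r = prim (n - 1 + alpha) (fun x => exp (u x)) r).
  { intros x Hx.
    apply (eq_half _ _ (fun r => pw r (n - 1 + alpha) * exp (u r))); auto.
    - now rewrite prim_0.
    - apply hcont_prim; auto; lra.
    - intros; apply dB; lra.
    - intros; apply (is_derive_prim _ (fun x => exp (u x))); auto; lra. }
  assert (EA : forall r, 0 <= r -> A r = prim (n - 1 + 0) v r).
  { intros x Hx.
    apply (eq_half _ _ (fun r => pw r (n - 1 + 0) * v r)); auto.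
    - now rewrite prim_0.
    - apply hcont_prim; auto; lra.
    - intros y Hy. rewrite Rplus_0_r. apply dA; lra.
    - intros; apply is_derive_prim; auto; lra. }
  split.
  - apply (eq_half v (fun r => beta + invlap n alpha (fun x => exp (u x)) r)
             (fun r => pw r (1 - n) * B r)); auto.
    + rewrite invlap_0, v0; ring.
    + apply hcont_plus; [apply hcont_const | apply hcont_invlap; auto].
    + intros; apply dv; lra.
    + intros x Hx. eapply D_eq.
      * apply D_plus; [apply D_const|]. apply is_derive_invlap; auto; lra.
      * rewrite EB by lra. ring.
  - apply (eq_half u (invlap n 0 v) (fun r => pw r (1 - n) * A r)); auto.
    + now rewrite invlap_0, u0.
    + apply hcont_invlap; auto; lra.
    + intros; apply du; lra.
    + intros x Hx. rewrite EA by lra. apply is_derive_invlap; auto; lra.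
Qed.

(** Half of the rate [c] absorbs the power r^a, and the other half is integrated explicitly; this is
    the origin of c / 2 and of the factor 2 / c. *)
Lemma prim_tail a f c D : -1 < a -> 0 < c -> 0 <= D -> hcont f ->
  (forall r, 1 <= r -> f r <= D * exp (- c * r)) ->
  exists C, 0 <= C /\ forall r s, 1 <= r -> r <= s ->
    prim a f s - prim a f r <= C * exp (- (c / 2) * r).
Proof.
  intros Ha Hc HD Hf Hb.
  destruct (pw_le_exp a (c / 2)) as [C0 [HC0 H0]]; [lra|].
  assert (HC : 0 <= C0 * D * (2 / c)).
  { apply Rmult_le_pos; [nra|]. left; apply Rdiv_lt_0_compat; lra. }
  exists (C0 * D * (2 / c)). split; [assumption|].
  intros r s Hr Hs.
  assert (prim a f s <= prim a f r
    + C0 * D * (2 / c) * (exp (- (c / 2) * r) - exp (- (c / 2) * s))).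
  { apply (le_pos (prim a f) (fun s => prim a f r
      + C0 * D * (2 / c) * (exp (- (c / 2) * r) - exp (- (c / 2) * s)))
      (fun s => pw s a * f s) (fun s => C0 * D * exp (- (c / 2) * s)) r s); auto.
    - lra.
    - intros x Hx. apply is_derive_prim; auto; lra.
    - intros x Hx. D. field; lra.
    - intros x Hx. assert (H1 : 1 <= x) by lra.
      specialize (H0 x H1). specialize (Hb x H1).
      apply Rle_trans with (pw x a * (D * exp (- c * x))).
      + apply Rmult_le_compat_l; [apply pw_ge0 | assumption].
      + apply Rle_trans with (C0 * exp (c / 2 * x) * (D * exp (- c * x))).
        * apply Rmult_le_compat_r; [|assumption].
          apply Rmult_le_pos; [assumption | left; apply exp_pos].
        * right. replace (- (c / 2) * x) with (c / 2 * x + - c * x) by field.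
          rewrite exp_plus. ring. }
  pose proof (exp_pos (- (c / 2) * s)). nra.
Qed.

(** Tangent line of exp at [b]. The slope is the value at the larger argument when a <= b, which the
    tube of the iteration controls. *)
Lemma exp_diff_le a b : exp b - exp a <= (b - a) * exp b.
Proof.
  pose proof (exp_ineq1_le (a - b)) as H.
  replace (exp a) with (exp (a - b) * exp b) by (rewrite <- exp_plus; f_equal; ring).
  pose proof (exp_pos b). nra.
Qed.

Lemma geom_small C e : 0 < e -> exists k, C * (/ 6) ^ k < e.
Proof.
  intros He.
  assert (HL : is_lim_seq (fun k => C * (/ 6) ^ k) 0).
  { replace (Finite 0) with (Rbar_mult C 0) by (simpl; f_equal; ring).
    apply is_lim_seq_scal_l, is_lim_seq_geom. rewrite Rabs_pos_eq; lra. }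
  apply is_lim_seq_spec in HL. destruct (HL (mkposreal e He)) as [k Hk].
  exists k. specialize (Hk k (le_n k)). simpl in Hk.
  rewrite Rminus_0_r in Hk. apply Rabs_def2 in Hk. lra.
Qed.

(** * Entire solutions persist when [Delta u] stays below a negative constant *)

Section Perturb.
Variables (n alpha beta L : R) (u v A B : R -> R).
Hypotheses (Hn : 3 <= n) (Ha : -2 < alpha) (HL : L < 0)
  (sys : rsys n alpha beta u v A B) (HvL : forall r, 0 < r -> v r <= L).

(** As Delta r^2 = 2 n, the bound v <= L integrates to u <= L r^2 / (2 n) = - d r^2. *)
Let d := - L / (2 * n).

Let d_pos : 0 < d.
Proof. unfold d. apply Rdiv_lt_0_compat; lra. Qed.

Let u_le r : 0 <= r -> u r <= - d * r ^ 2.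
Proof.
  intros Hr. destruct sys as [cu cv cA cB u0 v0 A0 B0 du dv dA dB].
  assert (HA : forall r, 0 < r -> A r <= L * (pw r n * / n)).
  { intros x Hx. apply (le_half A (fun r => L * (pw r n * / n))
      (fun r => pw r (n - 1) * v r) (fun r => L * pw r (n - 1))); auto; try lra.
    - rewrite A0, pw_nonpos by lra. lra.
    - hcont_tac.
    - intros; apply dA; lra.
    - intros y Hy. D. field; lra.
    - intros y Hy. pose proof (HvL y (proj1 Hy)). pose proof (pw_ge0 y (n - 1)). nra. }
  apply (le_half u (fun r => - d * r ^ 2)
    (fun r => pw r (1 - n) * A r) (fun r => - d * (2 * r))); auto.
  - rewrite u0; lra.
  - hcont_tac.
  - intros; apply du; lra.
  - intros x Hx. D. simpl; ring.
  - intros x Hx.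
    apply Rle_trans with (pw x (1 - n) * (L * (pw x n * / n))).
    + apply Rmult_le_compat_l; [apply pw_ge0 | apply HA; lra].
    + right. replace (pw x (1 - n) * (L * (pw x n * / n)))
        with (pw x (1 - n) * pw x n * (L * / n)) by ring.
      rewrite pw_add by lra. replace (1 - n + n) with 1 by ring.
      rewrite pw_one by lra. unfold d. field; lra.
Qed.

(** Dominates exp of every function lying below u + d r^2 / 2. Half of the quadratic decay of [u] is
    given away to the iterates, the other half keeps [h] integrable against powers. *)
Let h r := exp (u r + d / 2 * r ^ 2).

Let hcont_h : hcont h.
Proof. pose proof (rsys_u _ _ _ _ _ _ _ sys). unfold h. hcont_tac. Qed.

Let Pm := prim (3 + alpha) h.

Let hcont_Pm : hcont Pm.
Proof. apply hcont_prim; auto; lra. Qed.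

Let is_derive_Pm r : 0 < r -> is_derive Pm r (pw r (3 + alpha) * h r).
Proof. intros; apply is_derive_prim; auto; lra. Qed.

Let Pm_pos r : 0 <= r -> 0 <= Pm r.
Proof.
  intros Hr. apply prim_pos; auto; try lra.
  intros; left; apply exp_pos.
Qed.

Let Pm_mono r s : 0 < r -> r <= s -> Pm r <= Pm s.
Proof.
  intros Hr Hs. apply (incr_pos Pm (fun r => pw r (3 + alpha) * h r)); auto.
  - intros; apply is_derive_Pm; lra.
  - intros. apply Rmult_le_pos; [apply pw_ge0 | left; apply exp_pos].
Qed.

Let Pm_bounded : exists K, forall r, 0 <= r -> Pm r <= K.
Proof.
  (* For r >= 1 the Gaussian bound exp (- d r^2 / 2) is below exp (- d r / 2). *)
  destruct (prim_tail (3 + alpha) h (d / 2) 1) as [C [HC H]]; auto; try lra.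
  - intros r Hr. unfold h. rewrite Rmult_1_l. apply exp_le_exp.
    assert (Hr0 : 0 <= r) by lra. pose proof (u_le r Hr0).
    assert (0 <= d / 2 * (r * (r - 1))).
    { apply Rmult_le_pos; [lra | nra]. }
    simpl in *. lra.
  - exists (Pm 1 + C). intros r Hr.
    destruct (Rle_lt_dec r 1) as [H1|H1].
    + destruct Hr as [Hr| <-].
      * pose proof (Pm_mono r 1 Hr H1). lra.
      * pose proof (Pm_pos 1 Rle_0_1). assert (Pm 0 = 0) by apply prim_0. lra.
    + assert (E : exp (- (d / 2 / 2) * 1) <= 1).
      { rewrite <- exp_0 at 2. apply exp_le_exp. lra. }
      assert (H1' : 1 <= r) by lra.
      specialize (H 1 r (Rle_refl 1) H1'). fold Pm in H. nra.
Qed.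

(** A Bielecki weight: the exponential of the integral of the Lipschitz bound. The factor r^2 in
    [phi] is chosen so that r^(1+alpha) h phi is exactly E'. *)
Let E r := exp (Pm r).
Let phi r := r ^ 2 * E r.

Let E_ge1 r : 0 <= r -> 1 <= E r.
Proof.
  intros Hr. rewrite <- exp_0. apply exp_le_exp. now apply Pm_pos.
Qed.

Let hcont_E : hcont E.
Proof. now apply hcont_exp. Qed.

Let hcont_phi : hcont phi.
Proof. unfold phi. hcont_tac. Qed.

Let is_derive_E r : 0 < r -> is_derive E r (pw r (3 + alpha) * h r * E r).
Proof. intros Hr. apply D_exp. now apply is_derive_Pm. Qed.

Let prim_hphi r : 0 <= r -> prim (1 + alpha) (fun s => h s * phi s) r = E r - 1.
Proof.
  intros Hr.
  apply (eq_half _ (fun r => E r - 1) (fun r => pw r (1 + alpha) * (h r * phi r))); auto.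
  - rewrite prim_0. unfold E, Pm. rewrite prim_0, exp_0. ring.
  - apply hcont_prim; [lra | hcont_tac].
  - hcont_tac.
  - intros x Hx. apply (is_derive_prim _ (fun s => h s * phi s)); try lra. hcont_tac.
  - intros x Hx. eapply D_eq; [apply D_minus; [apply is_derive_E; lra | apply D_const]|].
    replace (3 + alpha) with (1 + alpha + 2) by ring.
    rewrite <- pw_add, pw_two by lra. unfold phi. ring.
Qed.

(** [E] is nondecreasing, so it may be pulled out of both integrals at the right endpoint; what
    remains is the inverse Laplacian of 1, namely r^2 / (2 n). *)
Let invlap_E r : 0 <= r -> invlap n 0 E r <= r ^ 2 * E r * / (2 * n).
Proof.
  intros Hr.
  assert (HP : forall r, 0 < r -> prim (n - 1 + 0) E r <= pw r n * E r * / n).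
  { intros x Hx.
    apply (le_half _ (fun r => pw r n * E r * / n) (fun r => pw r (n - 1 + 0) * E r)
      (fun r => pw r (n - 1) * E r + pw r n * (pw r (3 + alpha) * h r * E r) * / n));
      auto; try lra.
    - rewrite prim_0, pw_nonpos by lra. lra.
    - apply hcont_prim; auto; lra.
    - hcont_tac.
    - intros y Hy. apply is_derive_prim; auto; lra.
    - intros y Hy. eapply D_eq.
      + apply D_mult; [apply D_mult; [apply is_derive_pw; lra | apply is_derive_E; lra]
                      | apply D_const].
      + cbv beta. field; lra.
    - intros y Hy. replace (n - 1 + 0) with (n - 1) by ring.
      assert (0 <= pw y n * (pw y (3 + alpha) * h y * E y) * / n); [|lra].
      repeat apply Rmult_le_pos; try apply pw_ge0; try (left; apply exp_pos).
      left; apply Rinv_0_lt_compat; lra. }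
  apply (le_half _ (fun r => r ^ 2 * E r * / (2 * n))
    (fun r => pw r (1 - n) * prim (n - 1 + 0) E r)
    (fun r => r * E r * / n + r ^ 2 * (pw r (3 + alpha) * h r * E r) * / (2 * n))); auto.
  - rewrite invlap_0. lra.
  - apply hcont_invlap; auto; lra.
  - hcont_tac.
  - intros y Hy. apply is_derive_invlap; auto; lra.
  - intros y Hy. eapply D_eq.
    + apply D_mult; [apply D_mult; [apply D_pow, D_id | apply is_derive_E; lra]
                    | apply D_const].
    + simpl. field; lra.
  - intros y Hy.
    apply Rle_trans with (pw y (1 - n) * (pw y n * E y * / n)).
    + apply Rmult_le_compat_l; [apply pw_ge0 | apply HP; lra].
    + replace (pw y (1 - n) * (pw y n * E y * / n))
        with (pw y (1 - n) * pw y n * (E y * / n)) by ring.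
      rewrite pw_add by lra. replace (1 - n + n) with 1 by ring. rewrite pw_one by lra.
      assert (0 <= y ^ 2 * (pw y (3 + alpha) * h y * E y) * / (2 * n)); [|lra].
      repeat apply Rmult_le_pos; try apply pw_ge0; try (left; apply exp_pos); try lra.
      left; apply Rinv_0_lt_compat; lra.
Qed.

(* The weight [phi] makes the linearised problem contractive. *)
Let phi_contr r : 0 <= r ->
  invlap n 0 (invlap n alpha (fun s => h s * phi s)) r <= / 6 * phi r.
Proof.
  intros Hr.
  assert (chp : hcont (fun s => h s * phi s)) by hcont_tac.
  apply Rle_trans with (invlap n 0 E r).
  - assert (invlap n 0 (invlap n alpha (fun s => h s * phi s)) r
             <= invlap n 0 E r + 0 * invlap n 0 E r); [|lra].
    apply invlap_le; auto; try lra.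
    + apply hcont_invlap; auto; lra.
    + intros s Hs. assert (Hs0 : 0 <= s) by lra.
      pose proof (E_ge1 s Hs0).
      assert (H2 : invlap n alpha (fun s => h s * phi s) s <= / (n - 2) * (E s - 1)).
      { rewrite <- prim_hphi by assumption. apply invlap_le_prim; auto; try lra.
        intros x Hx. unfold phi. repeat apply Rmult_le_pos; try (left; apply exp_pos); lra. }
      assert (/ (n - 2) <= 1).
      { rewrite <- Rinv_1. apply Rinv_le_contravar; lra. }
      nra.
  - eapply Rle_trans; [now apply invlap_E|]. unfold phi.
    (* Source of the contraction factor 1/6: 2 n >= 6. *)
    assert (/ (2 * n) <= / 6) by (apply Rinv_le_contravar; lra).
    assert (0 <= r ^ 2 * E r).
    { apply Rmult_le_pos; [nra | left; apply exp_pos]. }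
    rewrite (Rmult_comm (/ 6)). now apply Rmult_le_compat_l.
Qed.

Let phi_pos r : 0 <= phi r.
Proof. unfold phi. apply Rmult_le_pos; [nra | left; apply exp_pos]. Qed.

Section Picard.
Variable eps : R.
Hypotheses (eps_pos : 0 < eps)
  (eps_small : forall r, 0 <= r -> 2 * eps * phi r <= d / 2 * r ^ 2).

(** The inverse Laplacian of the shift eps n is eps r^2 / 2, so the first iterate exceeds [u] by at
    most eps phi. *)
Let beta' := beta + eps * n.
Let T (f : R -> R) :=
  invlap n 0 (fun s => beta' + invlap n alpha (fun x => exp (f x)) s).
(** Since T u >= u and [T] is monotone, the iterates increase; only upper bounds have to be
    propagated. *)
Let U k := Nat.iter k T u.

Let hcont_inner f : hcont f ->
  hcont (fun s => beta' + invlap n alpha (fun x => exp (f x)) s).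
Proof.
  intros Hf. apply hcont_plus; [apply hcont_const|].
  apply hcont_invlap; auto; [lra | now apply hcont_exp].
Qed.

Let hcont_T f : hcont f -> hcont (T f).
Proof. intros Hf. apply hcont_invlap; auto; lra. Qed.

Let T_mono f g r : hcont f -> hcont g -> 0 <= r ->
  (forall s, 0 <= s -> f s <= g s) -> T f r <= T g r.
Proof.
  intros Hf Hg Hr Hl. unfold T.
  set (F := fun s => beta' + invlap n alpha (fun x => exp (f x)) s).
  set (G := fun s => beta' + invlap n alpha (fun x => exp (g x)) s).
  assert (invlap n 0 F r <= invlap n 0 G r + 0 * invlap n 0 G r); [|lra].
  assert (hcont F) by now apply hcont_inner. assert (hcont G) by now apply hcont_inner.
  apply invlap_le; auto; try lra.
  intros s Hs. unfold F, G.
  assert (invlap n alpha (fun x => exp (f x)) s <=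
    invlap n alpha (fun x => exp (g x)) s + 0 * invlap n alpha (fun x => exp (g x)) s);
    [|lra].
  apply invlap_le; try lra; try (apply hcont_exp; assumption).
  intros x Hx. assert (Hx0 : 0 <= x) by lra. pose proof (exp_le_exp _ _ (Hl x Hx0)). lra.
Qed.

(** Convexity gives e^g - e^f <= (g - f) e^g <= c phi h, the last step because [g] lies in the tube;
    then [phi_contr] applies. *)
Let T_contr f g c r : hcont f -> hcont g -> 0 <= r -> 0 <= c ->
  (forall s, 0 <= s -> f s <= g s <= f s + c * phi s) ->
  (forall s, 0 <= s -> g s <= u s + d / 2 * s ^ 2) ->
  T g r <= T f r + c * / 6 * phi r.
Proof.
  intros Hf Hg Hr Hc Hl Hu. unfold T.
  assert (chp : hcont (fun s => h s * phi s)) by hcont_tac.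
  set (F := fun s => beta' + invlap n alpha (fun x => exp (f x)) s).
  set (G := fun s => beta' + invlap n alpha (fun x => exp (g x)) s).
  assert (cF : hcont F) by now apply hcont_inner.
  assert (cG : hcont G) by now apply hcont_inner.
  assert (H : invlap n 0 G r <= invlap n 0 F r
     + c * invlap n 0 (invlap n alpha (fun s => h s * phi s)) r).
  { apply invlap_le; auto; try lra.
    - apply hcont_invlap; auto; lra.
    - intros s Hs. unfold F, G.
      assert (invlap n alpha (fun x => exp (g x)) s <=
        invlap n alpha (fun x => exp (f x)) s
        + c * invlap n alpha (fun s => h s * phi s) s); [|lra].
      apply invlap_le; auto; try lra; try (apply hcont_exp; assumption).
      intros x Hx. assert (Hx0 : 0 <= x) by lra.
      specialize (Hl x Hx0). specialize (Hu x Hx0).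
      pose proof (exp_diff_le (f x) (g x)) as H1.
      assert (H2 : exp (g x) <= h x) by (apply exp_le_exp; assumption).
      assert ((g x - f x) * exp (g x) <= (c * phi x) * h x).
      { apply Rmult_le_compat; try lra. left; apply exp_pos. }
      lra. }
  pose proof (phi_contr r Hr). nra.
Qed.

Let T_start r : 0 <= r -> u r <= T u r <= u r + eps * phi r.
Proof.
  intros Hr. pose proof (rsys_u _ _ _ _ _ _ _ sys) as cu.
  pose proof (rsys_v _ _ _ _ _ _ _ sys) as cv.
  pose proof (hcont_inner u cu) as cF.
  assert (H2n : 2 < n) by lra.
  pose proof (rsys_fixed_point _ _ _ _ _ _ _ H2n Ha sys) as FP.
  destruct (FP r Hr) as [_ Eu].
  assert (EF : forall s, 0 < s <= r ->
    beta' + invlap n alpha (fun x => exp (u x)) s = v s + eps * n).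
  { intros s Hs. assert (Hs0 : 0 <= s) by lra. destruct (FP s Hs0) as [Ev _].
    rewrite Ev. unfold beta'. ring. }
  split.
  - rewrite Eu at 1. unfold T.
    set (F := fun s => beta' + invlap n alpha (fun x => exp (u x)) s) in *.
    assert (invlap n 0 v r <= invlap n 0 F r + 0 * invlap n 0 F r); [|lra].
    apply invlap_le; auto; try lra.
    intros s Hs. unfold F. rewrite EF by assumption. nra.
  - rewrite Eu at 1. unfold T.
    set (F := fun s => beta' + invlap n alpha (fun x => exp (u x)) s) in *.
    assert (H : invlap n 0 F r <= invlap n 0 v r + (eps * n) * invlap n 0 (fun _ => 1) r).
    { apply invlap_le; auto using hcont_const; try lra.
      intros s Hs. unfold F. rewrite EF by assumption. lra. }
    rewrite invlap_const in H by lra.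
    replace (eps * n * (1 * r ^ 2 / (2 * n))) with (eps * (r ^ 2 * / 2)) in H
      by (field; lra).
    pose proof (E_ge1 r Hr). unfold phi.
    assert (r ^ 2 * / 2 <= r ^ 2 * E r) by (apply Rmult_le_compat_l; nra).
    nra.
Qed.

Let hcont_U k : hcont (U k).
Proof.
  induction k as [|k IH]; [apply (rsys_u _ _ _ _ _ _ _ sys)|]. now apply hcont_T.
Qed.

Let q k := eps * (/ 6) ^ k.

Let q_pos k : 0 < q k.
Proof. unfold q. apply Rmult_lt_0_compat; [assumption|]. apply pow_lt; lra. Qed.

(** The two claims need each other: the step estimate requires the iterate to lie in the tube, and
    the position is the sum of the earlier steps. The geometric sum of q 0, ..., q (k - 1) is 6/5
    (eps - q k), which stays below the 2 eps allowed by [eps_small]. *)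
Let U_step k : (forall r, 0 <= r -> U k r <= U (S k) r <= U k r + q k * phi r) /\
  (forall r, 0 <= r -> U k r <= u r + 6 / 5 * (eps - q k) * phi r).
Proof.
  induction k as [|k [IH1 IH2]].
  - split.
    + intros r Hr. unfold q. simpl. rewrite Rmult_1_r. now apply T_start.
    + intros r Hr. unfold q. simpl. lra.
  - assert (IH2' : forall r, 0 <= r ->
      U (S k) r <= u r + 6 / 5 * (eps - q (S k)) * phi r).
    { intros r Hr. specialize (IH1 r Hr). specialize (IH2 r Hr).
      replace (q (S k)) with (/ 6 * q k) by (unfold q; simpl; ring). lra. }
    split; [|assumption].
    intros r Hr. split.
    + apply T_mono; auto. intros s Hs. now apply IH1.
    + replace (q (S k)) with (q k * / 6) by (unfold q; simpl; ring).
      apply T_contr; auto.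
      * left; apply q_pos.
      * intros s Hs. eapply Rle_trans; [now apply IH2'|].
        pose proof (eps_small s Hs). pose proof (phi_pos s).
        pose proof (q_pos (S k)). nra.
Qed.

Let U_upper k j r : 0 <= r -> U j r <= U k r + 2 * q k * phi r.
Proof.
  intros Hr. pose proof (phi_pos r) as Hp.
  assert (M : forall i m, U i r <= U (m + i)%nat r).
  { intros i m; induction m as [|m IH]; [simpl; lra|].
    destruct (U_step (m + i)) as [H _]. specialize (H r Hr).
    change (S m + i)%nat with (S (m + i)). lra. }
  (* All steps from the i-th on add up to at most 6/5 q i phi, so U i + 6/5 q i phi is nonincreasing
     in i. Afterwards 6/5 is rounded up to 2. *)
  assert (W : forall i m, U (m + i)%nat r + 6 / 5 * q (m + i)%nat * phi r
                          <= U i r + 6 / 5 * q i * phi r).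
  { intros i m; induction m as [|m IH]; [simpl; lra|].
    destruct (U_step (m + i)) as [H _]. specialize (H r Hr).
    change (S m + i)%nat with (S (m + i)).
    replace (q (S (m + i))) with (/ 6 * q (m + i)%nat)
      by (unfold q; simpl; ring). lra. }
  pose proof (q_pos k) as Hq.
  destruct (Nat.le_ge_cases j k) as [Hjk|Hjk].
  - specialize (M j (k - j)%nat). replace (k - j + j)%nat with k in M by lia. nra.
  - specialize (W k (j - k)%nat). replace (j - k + k)%nat with j in W by lia.
    pose proof (q_pos j). nra.
Qed.

Let Ul r := real (Lim_seq (fun k => U k r)).

Let Ul_between k r : 0 <= r -> U k r <= Ul r <= U k r + 2 * q k * phi r.
Proof.
  intros Hr.
  assert (I : forall k, U k r <= U (S k) r).
  { intros j. apply (proj1 (U_step j)); assumption. }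
  assert (X : ex_finite_lim_seq (fun k => U k r)).
  { apply ex_finite_lim_seq_incr with (M := U 0%nat r + 2 * q 0 * phi r); auto. }
  apply Lim_seq_correct' in X. fold (Ul r) in X. split.
  - apply (is_lim_seq_incr_compare (fun k => U k r)); auto.
  - apply (is_lim_seq_le (fun j => U j r) (fun _ => U k r + 2 * q k * phi r)
      (Ul r) (U k r + 2 * q k * phi r)); auto.
    apply is_lim_seq_const.
Qed.

(** Convergence is locally uniform, because [phi] is bounded on bounded sets by the bound K of [Pm];
    the rest is an e/3 argument. *)
Let hcont_Ul : hcont Ul.
Proof.
  intros x. apply filterlim_locally. intros e.
  destruct Pm_bounded as [K HK].
  set (M := (Rabs x + 1) ^ 2 * exp K).
  assert (HM : forall t, Rabs (t - x) < 1 -> phi (Rmax 0 t) <= M).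
  { intros t Ht. unfold phi, M.
    assert (0 <= Rmax 0 t <= Rabs x + 1).
    { split; [apply Rmax_l|]. apply Rmax_lub.
      - pose proof (Rabs_pos x); lra.
      - pose proof (Rle_abs x). apply Rabs_def2 in Ht. lra. }
    apply Rmult_le_compat; [nra | left; apply exp_pos | nra |].
    apply exp_le_exp. apply HK, Rmax_l. }
  assert (He : 0 < pos e / 3) by (pose proof (cond_pos e); lra).
  destruct (geom_small (2 * eps * M) _ He) as [k Hk].
  assert (HqM : 2 * q k * M < e / 3) by (unfold q; lra).
  destruct (proj1 (filterlim_locally _ _) (hcont_U k x) (mkposreal _ He)) as [dl Hdl].
  assert (Hm : 0 < Rmin dl 1) by (apply Rmin_pos; [apply cond_pos | lra]).
  exists (mkposreal _ Hm). intros t Ht. rewrite ball_R in Ht. simpl in Ht.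
  assert (Ht1 : Rabs (t - x) < dl) by (eapply Rlt_le_trans; [apply Ht | apply Rmin_l]).
  assert (Ht2 : Rabs (t - x) < 1) by (eapply Rlt_le_trans; [apply Ht | apply Rmin_r]).
  specialize (Hdl t Ht1). rewrite ball_R in *. simpl in Hdl.
  assert (Hx1 : Rabs (x - x) < 1) by (rewrite Rminus_diag, Rabs_R0; lra).
  pose proof (HM t Ht2) as M1. pose proof (HM x Hx1) as M2.
  pose proof (Ul_between k _ (Rmax_l 0 t)) as B1.
  pose proof (Ul_between k _ (Rmax_l 0 x)) as B2.
  pose proof (q_pos k) as Hq.
  assert (2 * q k * phi (Rmax 0 t) <= 2 * q k * M) by (apply Rmult_le_compat_l; lra).
  assert (2 * q k * phi (Rmax 0 x) <= 2 * q k * M) by (apply Rmult_le_compat_l; lra).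
  apply Rabs_def2 in Hdl. apply Rabs_def1; lra.
Qed.

(** Both [Ul] and [T Ul] lie between U (S k) and U (S k) + q k phi / 3, by [Ul_between] for the
    first and by monotonicity and contraction of [T] for the second. The gap vanishes as k grows. *)
Let Ul_fixed r : 0 <= r -> Ul r = T Ul r.
Proof.
  intros Hr. pose proof (phi_pos r) as Hp.
  assert (Hb : forall k, Rabs (Ul r - T Ul r) <= 2 * eps * phi r * (/ 6) ^ k).
  { intros k.
    assert (H1 : T (U k) r <= T Ul r).
    { apply T_mono; auto. intros s Hs. now apply (Ul_between k). }
    assert (H2 : T Ul r <= T (U k) r + 2 * q k * / 6 * phi r).
    { apply T_contr; auto.
      - pose proof (q_pos k); lra.
      - intros s Hs. pose proof (Ul_between 0%nat s Hs) as X. unfold q in X.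
        simpl in X. rewrite Rmult_1_r in X. pose proof (eps_small s Hs). lra. }
    change (T (U k) r) with (U (S k) r) in *.
    pose proof (Ul_between (S k) r Hr) as H3.
    replace (q (S k)) with (/ 6 * q k) in H3 by (unfold q; simpl; ring).
    replace (2 * eps * phi r * (/ 6) ^ k) with (2 * (q k * phi r)) by (unfold q; ring).
    assert (0 <= q k * phi r) by (apply Rmult_le_pos; [left; apply q_pos | assumption]).
    apply Rabs_le. lra. }
  destruct (Req_dec (Ul r - T Ul r) 0) as [H0|H0]; [lra|].
  apply Rabs_pos_lt in H0. destruct (geom_small (2 * eps * phi r) _ H0) as [k Hk].
  specialize (Hb k). lra.
Qed.

Lemma perturb_fixed_point : exists f, hcont f /\ forall r, 0 <= r ->
  f r = invlap n 0
    (fun s => beta + eps * n + invlap n alpha (fun x => exp (f x)) s) r.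
Proof. exists Ul. split; [exact hcont_Ul | exact Ul_fixed]. Qed.

End Picard.

Lemma perturb : exists b f, beta < b /\ hcont f /\ forall r, 0 <= r ->
  f r = invlap n 0 (fun s => b + invlap n alpha (fun x => exp (f x)) s) r.
Proof.
  destruct Pm_bounded as [K HK]. pose proof (exp_pos K) as HeK.
  (* As E <= exp K, this makes 2 eps phi <= 2 eps r^2 exp K = d r^2 / 2. *)
  set (eps := d / (4 * exp K)).
  assert (He : 0 < eps) by (apply Rdiv_lt_0_compat; lra).
  destruct (perturb_fixed_point eps He) as [f Hf].
  - intros r Hr. unfold phi.
    assert (E r <= exp K) by (apply exp_le_exp; now apply HK).
    replace (d / 2 * r ^ 2) with (2 * eps * (r ^ 2 * exp K)) by (unfold eps; field; lra).
    apply Rmult_le_compat_l; [lra|]. apply Rmult_le_compat_l; nra.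
  - exists (beta + eps * n), f. split; [nra | exact Hf].
Qed.

End Perturb.

(** * Limits at infinity *)

Lemma lim_infty_intro (f : R -> R) (l : R) :
  (forall e, 0 < e -> exists M, forall x, M < x -> Rabs (f x - l) < e) ->
  is_lim f p_infty l.
Proof.
  intros H. apply is_lim_spec. intros e. destruct (H e (cond_pos e)) as [M HM].
  exists M. exact HM.
Qed.

Lemma lim_infty_elim (f : R -> R) (l : R) : is_lim f p_infty l ->
  forall e, 0 < e -> exists M, forall x, M < x -> Rabs (f x - l) < e.
Proof.
  intros H e He. apply is_lim_spec in H. exact (H (mkposreal e He)).
Qed.

Lemma lim_incr f a M : (forall x y, a <= x -> x <= y -> f x <= f y) ->
  (forall x, a <= x -> f x <= M) ->
  exists l : R, is_lim f p_infty l /\ l <= M /\ forall x, a <= x -> f x <= l.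
Proof.
  intros Hi Hb.
  destruct (completeness (fun y => exists x, a <= x /\ y = f x)) as [l [Hl1 Hl2]].
  - exists M. intros y [x [Hx ->]]. now apply Hb.
  - exists (f a), a. split; [lra | reflexivity].
  - assert (Hub : forall x, a <= x -> f x <= l) by (intros x Hx; apply Hl1; eauto).
    exists l. split; [|split].
    + apply lim_infty_intro. intros e He.
      destruct (Classical_Prop.classic (exists x, a <= x /\ l - e < f x))
        as [[x0 [Hx0 H0]]|Hno].
      * exists x0. intros x Hx. assert (a <= x) by lra.
        pose proof (Hub x H). assert (Hxx : x0 <= x) by lra.
        pose proof (Hi x0 x Hx0 Hxx). apply Rabs_def1; lra.
      * exfalso. assert (l <= l - e); [|lra].
        apply Hl2. intros y [x [Hx ->]]. apply Rnot_lt_le. intros C.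
        apply Hno. eauto.
    + apply Hl2. intros y [x [Hx ->]]. now apply Hb.
    + exact Hub.
Qed.

Lemma lim_le (f : R -> R) (l c M : R) : is_lim f p_infty l ->
  (forall x, M <= x -> f x <= c) -> l <= c.
Proof.
  intros H Hc. apply Rnot_lt_le. intros C.
  assert (He : 0 < l - c) by lra.
  destruct (lim_infty_elim f l H _ He) as [M' HM'].
  specialize (HM' (Rmax M M' + 1)). specialize (Hc (Rmax M M' + 1)).
  pose proof (Rmax_l M M'). pose proof (Rmax_r M M').
  assert (X1 : M' < Rmax M M' + 1) by lra. assert (X2 : M <= Rmax M M' + 1) by lra.
  specialize (HM' X1). specialize (Hc X2). apply Rabs_def2 in HM'. lra.
Qed.

(** * The Laplacian of an entire solution is nonpositive *)

Section Blowup.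
Variables (n alpha beta : R) (u v A B : R -> R).
Hypotheses (Hn : 3 <= n) (Ha : -2 < alpha) (sys : rsys n alpha beta u v A B).

Lemma rsys_B_pos r : 0 <= r -> 0 <= B r.
Proof.
  intros Hr. destruct sys as [cu cv cA cB u0 v0 A0 B0 du dv dA dB]. rewrite <- B0.
  apply (incr_half B (fun r => pw r (n - 1 + alpha) * exp (u r))); auto.
  - intros; apply dB; lra.
  - intros. apply Rmult_le_pos; [apply pw_ge0 | left; apply exp_pos].
Qed.

Lemma rsys_B_mono r s : 0 < r -> r <= s -> B r <= B s.
Proof.
  intros Hr Hs. destruct sys as [cu cv cA cB u0 v0 A0 B0 du dv dA dB].
  apply (incr_pos B (fun r => pw r (n - 1 + alpha) * exp (u r))); auto.
  - intros; apply dB; lra.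
  - intros. apply Rmult_le_pos; [apply pw_ge0 | left; apply exp_pos].
Qed.

Lemma rsys_v_mono r s : 0 < r -> r <= s -> v r <= v s.
Proof.
  intros Hr Hs. destruct sys as [cu cv cA cB u0 v0 A0 B0 du dv dA dB].
  apply (incr_pos v (fun r => pw r (1 - n) * B r)); auto.
  - intros; apply dv; lra.
  - intros. apply Rmult_le_pos; [apply pw_ge0 | apply rsys_B_pos; lra].
Qed.

(** [v] stays above k = v r0, so [A] grows at least like k r^n / n up to the constant K, which
    overtakes r^(n-1) once k r / n >= K + 1. The purpose is u' >= 1. *)
Let A_large r0 : 0 < r0 -> 0 < v r0 ->
  exists R1, 1 <= R1 /\ r0 <= R1 /\ forall r, R1 <= r -> pw r (n - 1) <= A r.
Proof.
  intros Hr0 Hv0. set (k := v r0) in *.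
  pose proof (rsys_dA _ _ _ _ _ _ _ sys) as dA.
  set (K := Rabs (A r0 - k / n * pw r0 n)).
  exists (Rmax 1 (Rmax r0 ((K + 1) * n / k))).
  split; [apply Rmax_l|]. split.
  { eapply Rle_trans; [apply Rmax_l | apply Rmax_r]. }
  intros r Hr.
  assert (H1 : 1 <= r) by (eapply Rle_trans; [apply Rmax_l | apply Hr]).
  assert (H2 : r0 <= r).
  { eapply Rle_trans; [|apply Hr]. eapply Rle_trans; [apply Rmax_l | apply Rmax_r]. }
  assert (H3 : (K + 1) * n / k <= r).
  { eapply Rle_trans; [|apply Hr]. eapply Rle_trans; [apply Rmax_r | apply Rmax_r]. }
  assert (HA : A r0 + k / n * (pw r n - pw r0 n) <= A r).
  { apply (le_pos (fun r => A r0 + k / n * (pw r n - pw r0 n)) A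
      (fun r => k * pw r (n - 1)) (fun r => pw r (n - 1) * v r) r0 r); auto.
    - lra.
    - intros x Hx. D. field; lra.
    - intros; apply dA; lra.
    - intros x Hx. pose proof (rsys_v_mono r0 x Hr0 (proj1 Hx)). fold k in H.
      pose proof (pw_ge0 x (n - 1)). nra. }
  assert (HK : - K <= A r0 - k / n * pw r0 n).
  { unfold K. pose proof (Rle_abs (- (A r0 - k / n * pw r0 n))).
    rewrite Rabs_Ropp in H. lra. }
  assert (E : pw r n = r * pw r (n - 1)).
  { rewrite <- (pw_one r) at 2 by lra. rewrite pw_add by lra. f_equal; ring. }
  assert (P1 : 1 <= pw r (n - 1)).
  { apply pw_ge1; lra. }
  assert (HK0 : 0 <= K) by apply Rabs_pos.
  assert (H4 : K + 1 <= k / n * r).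
  { apply Rmult_le_reg_r with (n / k); [apply Rdiv_lt_0_compat; lra|].
    replace (k / n * r * (n / k)) with r by (field; lra).
    replace ((K + 1) * (n / k)) with ((K + 1) * n / k) by (field; lra). assumption. }
  rewrite E in HA.
  assert ((K + 1) * pw r (n - 1) <= k / n * r * pw r (n - 1))
    by (apply Rmult_le_compat_r; lra).
  nra.
Qed.

(** Four successive integrations from [a], for B, v, A and u, with e^u kept at its value at [a] and
    each power frozen at its minimum over [rho, rho + 2]; they produce h^4 / 24. The length 2 is the
    sum of the steps 1, 1/2, 1/4, ... used later. *)
Let u_jump rho a h : 0 < rho -> rho <= a -> 0 <= h -> a + h <= rho + 2 ->
  (forall r, rho <= r -> 0 <= A r) -> (forall r, rho <= r -> 0 <= v r) ->
  u a + pw (rho + 2) (1 - n) * pw rho (n - 1)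
        * (pw (rho + 2) (1 - n) * pw rho (n - 1 + alpha)) / 24 * h ^ 4 * exp (u a)
  <= u (a + h).
Proof.
  intros Hrho Hra Hh Hah HA Hv.
  destruct sys as [cu cv cA cB u0 v0 A0 B0 du dv dA dB].
  set (p := pw (rho + 2) (1 - n)). set (q := pw rho (n - 1)).
  set (q' := pw rho (n - 1 + alpha)). set (e := exp (u a)).
  assert (Hp : 0 < p) by (apply pw_gt0; lra).
  assert (Hq : 0 < q) by (apply pw_gt0; lra).
  assert (Hq' : 0 < q') by (apply pw_gt0; lra).
  assert (He : 0 < e) by apply exp_pos.
  assert (Lp : forall r, a <= r <= a + h -> p <= pw r (1 - n)).
  { intros r Hr. unfold p. replace (1 - n) with (- (n - 1)) by ring.
    rewrite !pw_inv by lra. apply Rinv_le_contravar; [apply pw_gt0; lra|].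
    apply pw_le; lra. }
  assert (Lq : forall r, a <= r <= a + h -> q <= pw r (n - 1)) by (intros; apply pw_le; lra).
  assert (Lq' : forall r, a <= r <= a + h -> q' <= pw r (n - 1 + alpha))
    by (intros; apply pw_le; lra).
  assert (Lu : forall r, a <= r <= a + h -> u a <= u r).
  { intros r Hr. apply (incr_pos u (fun r => pw r (1 - n) * A r)); try lra.
    - intros; apply du; lra.
    - intros. apply Rmult_le_pos; [apply pw_ge0 | apply HA; lra]. }
  assert (LB : forall r, a <= r <= a + h -> q' * e * (r - a) <= B r).
  { intros r Hr. apply (le_pos (fun r => q' * e * (r - a)) B (fun _ => q' * e)
      (fun r => pw r (n - 1 + alpha) * exp (u r)) a r); try lra.
    - rewrite Rminus_diag, Rmult_0_r. apply rsys_B_pos; lra.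
    - intros x Hx. D. ring.
    - intros; apply dB; lra.
    - intros x Hx. apply Rmult_le_compat; try lra; [apply Lq'; lra|].
      apply exp_le_exp, Lu; lra. }
  assert (Lv : forall r, a <= r <= a + h -> p * q' * e * ((r - a) ^ 2 * / 2) <= v r).
  { intros r Hr. apply (le_pos (fun r => p * q' * e * ((r - a) ^ 2 * / 2)) v
      (fun r => p * (q' * e * (r - a))) (fun r => pw r (1 - n) * B r) a r); try lra.
    - rewrite Rminus_diag. replace (p * q' * e * (0 ^ 2 * / 2)) with 0 by (simpl; ring).
      apply Hv; lra.
    - intros x Hx. D. simpl. field.
    - intros; apply dv; lra.
    - intros x Hx. apply Rmult_le_compat; try lra; [|apply Lp; lra | apply LB; lra].
      apply Rmult_le_pos; [apply Rmult_le_pos; lra | lra]. }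
  assert (LA : forall r, a <= r <= a + h -> q * (p * q' * e * ((r - a) ^ 3 * / 6)) <= A r).
  { intros r Hr. apply (le_pos (fun r => q * (p * q' * e * ((r - a) ^ 3 * / 6))) A
      (fun r => q * (p * q' * e * ((r - a) ^ 2 * / 2)))
      (fun r => pw r (n - 1) * v r) a r); try lra.
    - rewrite Rminus_diag. replace (q * (p * q' * e * (0 ^ 3 * / 6))) with 0 by (simpl; ring).
      apply HA; lra.
    - intros x Hx. D. simpl. field.
    - intros; apply dA; lra.
    - intros x Hx. apply Rmult_le_compat; try lra; [|apply Lq; lra | apply Lv; lra].
      repeat apply Rmult_le_pos; nra || lra. }
  assert (Lu4 : u a + p * (q * (p * q' * e * ((a + h - a) ^ 4 * / 24))) <= u (a + h)).
  { apply (le_pos (fun r => u a + p * (q * (p * q' * e * ((r - a) ^ 4 * / 24)))) u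
      (fun r => p * (q * (p * q' * e * ((r - a) ^ 3 * / 6))))
      (fun r => pw r (1 - n) * A r) a (a + h)); try lra.
    - intros x Hx. D. simpl. field.
    - intros; apply du; lra.
    - intros x Hx. apply Rmult_le_compat; try lra; [|apply Lp; lra | apply LA; lra].
      repeat apply Rmult_le_pos; nra || lra. }
  replace (a + h - a) with h in Lu4 by ring.
  eapply Rle_trans; [right | apply Lu4]. field.
Qed.

(** A gain of 4 in [u] multiplies e^u by at least 16, which pays for halving the step in h^4. *)
Let exp_4_ge : 16 <= exp 4.
Proof.
  pose proof (exp_ineq1_le 1) as H. assert (H2 : 2 <= exp 1) by lra.
  assert (H4 : 4 <= exp 2).
  { replace 2 with (1 + 1) by ring. rewrite exp_plus. nra. }
  replace (exp 4) with (exp 2 * exp 2) by (rewrite <- exp_plus; f_equal; ring). nra.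
Qed.

Lemma rsys_v_nonpos r0 : 0 < r0 -> v r0 <= 0.
Proof.
  intros Hr0. apply Rnot_lt_le. intros Hv0.
  destruct (A_large r0 Hr0 Hv0) as [R1 [H1 [H2 HA]]].
  pose proof (rsys_du _ _ _ _ _ _ _ sys) as du.
  assert (HA0 : forall r, R1 <= r -> 0 <= A r).
  { intros r Hr. eapply Rle_trans; [apply pw_ge0 | now apply HA]. }
  assert (Hv : forall r, R1 <= r -> 0 <= v r).
  { intros r Hr. assert (H3 : r0 <= r) by lra. pose proof (rsys_v_mono r0 r Hr0 H3). lra. }
  assert (Hu : forall r, R1 <= r -> u R1 + (r - R1) <= u r).
  { intros r Hr. apply (le_pos (fun r => u R1 + (r - R1)) u (fun _ => 1)
      (fun r => pw r (1 - n) * A r) R1 r); auto; try lra.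
    - intros x Hx. D. ring.
    - intros; apply du; lra.
    - intros x Hx. apply Rle_trans with (pw x (1 - n) * pw x (n - 1));
        [right; symmetry; apply pw_mul_1; lra|].
      apply Rmult_le_compat_l; [apply pw_ge0 | apply HA; lra]. }
  (* The factor (rho + 2)^(2 - 2 n) in [c] costs at most an exponential of rate 1/2, while e^u grows
     at rate at least 1. *)
  destruct (pw_le_exp (2 * (n - 1)) (/ 2)) as [C [HC HCe]]; [lra|].
  (* Chosen so that u rho >= ln (96 C) + (rho + 2) / 2. Here 96 = 4 * 24, with 24 from [u_jump] and
     4 the gain wanted at each step. *)
  set (rho := Rmax R1 (2 * (ln (96 * C) + 1 + R1 - u R1))).
  assert (Hrho : R1 <= rho) by apply Rmax_l.
  assert (Hrho2 : 2 * (ln (96 * C) + 1 + R1 - u R1) <= rho) by apply Rmax_r.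
  set (c := pw (rho + 2) (1 - n) * pw rho (n - 1)
            * (pw (rho + 2) (1 - n) * pw rho (n - 1 + alpha)) / 24).
  assert (Hc : 4 <= c * exp (u rho)).
  { assert (P2 : / (C * exp (/ 2 * (rho + 2))) <= pw (rho + 2) (1 - n) * pw (rho + 2) (1 - n)).
    { rewrite pw_add by lra. replace (1 - n + (1 - n)) with (- (2 * (n - 1))) by ring.
      rewrite pw_inv by lra. apply Rinv_le_contravar; [apply pw_gt0; lra|].
      apply HCe; lra. }
    assert (P3 : 1 <= pw rho (n - 1) * pw rho (n - 1 + alpha)).
    { rewrite pw_add by lra. apply pw_ge1; lra. }
    assert (Pc : / (C * exp (/ 2 * (rho + 2))) / 24 <= c).
    { unfold c.
      set (x := / (C * exp (/ 2 * (rho + 2)))) in *.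
      set (y := pw (rho + 2) (1 - n)) in *.
      set (z := pw rho (n - 1)) in *. set (w := pw rho (n - 1 + alpha)) in *.
      assert (0 <= y * y) by nra.
      replace (y * z * (y * w) / 24) with ((y * y) * (z * w) / 24) by field.
      assert (x <= y * y * (z * w)); [|lra].
      eapply Rle_trans; [apply P2|]. rewrite <- (Rmult_1_r (y * y)) at 1.
      now apply Rmult_le_compat_l. }
    assert (Pu : 96 * C * exp (/ 2 * (rho + 2)) <= exp (u rho)).
    { rewrite <- (exp_ln (96 * C)) by lra. rewrite <- exp_plus. apply exp_le_exp.
      pose proof (Hu rho Hrho). lra. }
    pose proof (exp_pos (/ 2 * (rho + 2))) as He.
    apply Rle_trans with (/ (C * exp (/ 2 * (rho + 2))) / 24 * exp (u rho)).
    - apply Rle_trans with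
        (/ (C * exp (/ 2 * (rho + 2))) / 24 * (96 * C * exp (/ 2 * (rho + 2)))).
      + right. field. split; lra.
      + apply Rmult_le_compat_l; [|assumption].
        left. apply Rdiv_lt_0_compat; [|lra]. apply Rinv_0_lt_compat. nra.
    - apply Rmult_le_compat_r; [left; apply exp_pos | assumption]. }
  assert (Hc0 : 0 <= c).
  { unfold c. repeat apply Rmult_le_pos; try apply pw_ge0; lra. }
  (* Step k has length 2^-k: the loss 16^-k in h^4 is balanced by e^u having grown by 16^k, so the
     gain is again at least 4. *)
  assert (Hit : forall k, u rho + 4 * INR k <= u (rho + 2 - 2 * (/ 2) ^ k)).
  { induction k as [|k IH].
    - simpl. right. rewrite Rmult_0_r, Rplus_0_r. f_equal. ring.
    - assert (Hh : 0 < (/ 2) ^ k) by (apply pow_lt; lra).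
      assert (Hh1 : (/ 2) ^ k <= 1).
      { clear. induction k as [|k IH]; simpl; [lra|].
        assert (0 < (/ 2) ^ k) by (apply pow_lt; lra). lra. }
      pose proof (u_jump rho (rho + 2 - 2 * (/ 2) ^ k) ((/ 2) ^ k)) as J.
      replace (rho + 2 - 2 * (/ 2) ^ S k)
        with (rho + 2 - 2 * (/ 2) ^ k + (/ 2) ^ k) by (simpl; field).
      rewrite S_INR.
      eapply Rle_trans; [|apply J]; try lra; try (intros; apply HA0 || apply Hv; lra).
      fold c. set (x := u (rho + 2 - 2 * (/ 2) ^ k)) in *.
      assert (4 <= c * ((/ 2) ^ k) ^ 4 * exp x); [|lra].
      assert (Hx : exp (u rho) * 16 ^ k <= exp x).
      { eapply Rle_trans; [|apply exp_le_exp, IH]. rewrite exp_plus.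
        apply Rmult_le_compat_l; [left; apply exp_pos|].
        clear -exp_4_ge. induction k as [|k IH].
        - simpl. rewrite Rmult_0_r, exp_0. lra.
        - rewrite S_INR. replace (4 * (INR k + 1)) with (4 + 4 * INR k) by ring.
          rewrite exp_plus. simpl. apply Rmult_le_compat; try lra.
          apply pow_le; lra. }
      apply Rle_trans with (c * ((/ 2) ^ k) ^ 4 * (exp (u rho) * 16 ^ k)).
      + replace (c * ((/ 2) ^ k) ^ 4 * (exp (u rho) * 16 ^ k))
          with (c * exp (u rho) * (((/ 2) ^ k) ^ 4 * 16 ^ k)) by ring.
        replace (((/ 2) ^ k) ^ 4 * 16 ^ k) with 1; [lra|].
        rewrite <- pow_mult, Nat.mul_comm, pow_mult, <- Rpow_mult_distr.
        replace ((/ 2) ^ 4 * 16) with 1 by (simpl; field). now rewrite pow1.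
      + apply Rmult_le_compat_l; [|assumption].
        apply Rmult_le_pos; [assumption | apply pow_le; lra]. }
  (* All points reached lie below rho + 2, where the finite value of the nondecreasing function [u]
     bounds the gains; infinitely many gains of 4 contradict this. *)
  destruct (INR_unbounded (u (rho + 2) - u rho)) as [k Hk].
  assert (Hh : 0 < (/ 2) ^ k) by (apply pow_lt; lra).
  assert (Hh1 : (/ 2) ^ k <= 1).
  { clear. induction k as [|k IH]; simpl; [lra|].
    assert (0 < (/ 2) ^ k) by (apply pow_lt; lra). lra. }
  specialize (Hit k).
  assert (Hm : u (rho + 2 - 2 * (/ 2) ^ k) <= u (rho + 2)).
  { apply (incr_pos u (fun r => pw r (1 - n) * A r)); try lra.
    - intros; apply du; lra.
    - intros. apply Rmult_le_pos; [apply pw_ge0 | apply HA0; lra]. }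
  pose proof (pos_INR k). lra.
Qed.

End Blowup.

Lemma critical_v_lim N alpha beta0 u v A B : (3 <= N)%nat -> -2 < alpha ->
  is_lub (fun beta => entire N alpha beta) beta0 ->
  rsys (INR N) alpha beta0 u v A B -> is_lim v p_infty 0.
Proof.
  intros HN Ha [Hub _] sys.
  pose proof (le_INR _ _ HN) as HN'. simpl in HN'.
  assert (Hn : 3 <= INR N) by lra.
  destruct (lim_incr v 1 0) as [l [Hl [Hl0 Hle]]].
  - intros x y Hx Hy. apply (rsys_v_mono _ _ _ _ _ _ _ sys); lra.
  - intros x Hx. apply (rsys_v_nonpos _ _ _ _ _ _ _ Hn Ha sys); lra.
  - destruct Hl0 as [Hl0| ->]; [exfalso|assumption].
    assert (HvL : forall r, 0 < r -> v r <= l).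
    { intros r Hr. destruct (Rle_lt_dec 1 r) as [H1|H1]; [now apply Hle|].
      apply Rle_trans with (v 1); [|apply Hle; lra].
      apply (rsys_v_mono _ _ _ _ _ _ _ sys); lra. }
    destruct (perturb _ _ _ _ _ _ _ _ Hn Ha Hl0 sys HvL) as [b [f [Hb [cf Hf]]]].
    assert (b <= beta0); [|lra].
    apply Hub. exact (fixed_point_entire N alpha b f HN Ha cf Hf).
Qed.

(** * Pointwise estimates for the critical solution *)

Section Estimates.
Variables (n alpha beta : R) (u v A B : R -> R).
Hypotheses (Hn : 3 <= n) (Ha : -2 < alpha) (sys : rsys n alpha beta u v A B)
  (Hv : is_lim v p_infty 0).

Let cu := rsys_u _ _ _ _ _ _ _ sys.
Let cv := rsys_v _ _ _ _ _ _ _ sys.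
Let cA := rsys_A _ _ _ _ _ _ _ sys.
Let cB := rsys_B _ _ _ _ _ _ _ sys.
Let du := rsys_du _ _ _ _ _ _ _ sys.
Let dv := rsys_dv _ _ _ _ _ _ _ sys.
Let dA := rsys_dA _ _ _ _ _ _ _ sys.
Let dB := rsys_dB _ _ _ _ _ _ _ sys.

Lemma rsys_A_nonpos r : 0 <= r -> A r <= 0.
Proof.
  intros Hr. rewrite <- (rsys_A0 _ _ _ _ _ _ _ sys).
  assert (- A 0 <= - A r); [|lra].
  apply (incr_half (fun r => - A r) (fun r => - (pw r (n - 1) * v r))); auto.
  - hcont_tac.
  - intros x Hx. apply D_opp, dA; lra.
  - intros x Hx. pose proof (rsys_v_nonpos _ _ _ _ _ _ _ Hn Ha sys x (proj1 Hx)).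
    pose proof (pw_ge0 x (n - 1)). nra.
Qed.

Lemma rsys_u_nonpos r : 0 <= r -> u r <= 0.
Proof.
  intros Hr. pose proof (rsys_u0 _ _ _ _ _ _ _ sys) as u0.
  assert (- u 0 <= - u r); [|lra].
  apply (incr_half (fun r => - u r) (fun r => - (pw r (1 - n) * A r))); auto.
  - hcont_tac.
  - intros x Hx. apply D_opp, du; lra.
  - intros x Hx. assert (Hx0 : 0 <= x) by lra. pose proof (rsys_A_nonpos x Hx0).
    pose proof (pw_ge0 x (1 - n)). nra.
Qed.

(** [u] is nonincreasing, so in the integral for [B] the factor e^u is at least its value at the
    right endpoint. *)
Lemma rsys_B_ge r : 0 < r -> exp (u r) * (pw r (n + alpha) * / (n + alpha)) <= B r.
Proof.
  intros Hr.
  apply (le_half (fun r => exp (u r) * (pw r (n + alpha) * / (n + alpha))) B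
    (fun r => pw r (1 - n) * A r * exp (u r) * (pw r (n + alpha) * / (n + alpha))
              + exp (u r) * pw r (n - 1 + alpha))
    (fun r => pw r (n - 1 + alpha) * exp (u r))); auto; try lra.
  - rewrite pw_nonpos, (rsys_B0 _ _ _ _ _ _ _ sys) by lra. lra.
  - hcont_tac.
  - intros x Hx. eapply D_eq.
    + apply D_mult; [apply D_exp, du; lra|].
      apply D_mult; [apply is_derive_pw; lra | apply D_const].
    + cbv beta. replace (n + alpha - 1) with (n - 1 + alpha) by ring. field; lra.
  - intros; apply dB; lra.
  - intros x Hx. assert (Hx0 : 0 <= x) by lra. pose proof (rsys_A_nonpos x Hx0).
    assert (0 <= - A x * (pw x (1 - n) * exp (u x) * (pw x (n + alpha) * / (n + alpha))));
      [|lra].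
    repeat apply Rmult_le_pos; try apply pw_ge0; try lra.
    + left; apply exp_pos.
    + left; apply Rinv_0_lt_compat; lra.
Qed.

(** Comparison with the fundamental solution s^(2-n): beyond r, [B] is at least B r, so v + s^(2-n)
    B r / (n - 2) is nondecreasing. Were it positive at r, [v] would become positive as s^(2-n) dies
    out. *)
Lemma rsys_v_le r : 0 < r -> pw r (2 - n) * (B r * / (n - 2)) <= - v r.
Proof.
  intros Hr.
  assert (H : v r + pw r (2 - n) * (B r * / (n - 2)) <= 0); [|lra].
  assert (HI : 0 < / (n - 2)) by (apply Rinv_0_lt_compat; lra).
  assert (LB : 0 <= B r) by (apply (rsys_B_pos _ _ _ _ _ _ _ sys); lra).
  set (K := B r * / (n - 2)) in *. assert (HK : 0 <= K) by (unfold K; nra).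
  apply Rnot_lt_le. intros C.
  set (e := v r + pw r (2 - n) * K) in *.
  assert (Hm : forall s, r <= s -> e <= v s + pw s (2 - n) * K).
  { intros s Hs.
    apply (incr_pos (fun s => v s + pw s (2 - n) * K)
      (fun s => pw s (1 - n) * (B s - B r)) r s Hs).
    - intros x Hx. eapply D_eq.
      + apply D_plus; [apply dv; lra|].
        apply D_mult; [apply is_derive_pw; lra | apply D_const].
      + cbv beta. replace (2 - n - 1) with (1 - n) by ring. unfold K. field; lra.
    - intros x Hx. apply Rmult_le_pos; [apply pw_ge0|].
      pose proof (rsys_B_mono _ _ _ _ _ _ _ sys r x Hr (proj1 Hx)). lra. }
  (* Far enough that s^(2-n) K <= K / s <= e / 2, leaving v s >= e / 2 > 0. *)
  set (s := Rmax (Rmax r 1) (2 * K / e)).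
  assert (S1 : Rmax r 1 <= s) by apply Rmax_l.
  assert (S2 : 2 * K / e <= s) by apply Rmax_r.
  pose proof (Rmax_l r 1). pose proof (Rmax_r r 1).
  assert (Hrs : r <= s) by lra.
  specialize (Hm s Hrs).
  assert (Hs0 : 0 < s) by lra.
  pose proof (rsys_v_nonpos _ _ _ _ _ _ _ Hn Ha sys s Hs0) as Hvs.
  assert (Hp : pw s (2 - n) <= / s).
  { rewrite <- (pw_one s) at 2 by assumption. rewrite <- pw_inv by assumption.
    rewrite !pw_eq by assumption. apply Rle_Rpower; lra. }
  assert (K <= e / 2 * s).
  { apply Rmult_le_reg_r with (2 / e); [apply Rdiv_lt_0_compat; lra|].
    replace (e / 2 * s * (2 / e)) with s by (field; lra).
    replace (K * (2 / e)) with (2 * K / e) by (field; lra). assumption. }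
  assert (K * / s <= e / 2).
  { apply Rmult_le_reg_r with s; [assumption|].
    replace (K * / s * s) with K by (field; lra). assumption. }
  assert (pw s (2 - n) * K <= / s * K) by (apply Rmult_le_compat_r; assumption).
  lra.
Qed.

(** The same freezing at the right endpoint, now because - v is nonincreasing. *)
Lemma rsys_A_le r : 0 < r -> pw r n * (- v r * / n) <= - A r.
Proof.
  intros Hr.
  apply (le_half (fun r => pw r n * (- v r * / n)) (fun r => - A r)
    (fun r => - (pw r (n - 1) * v r) - pw r n * (pw r (1 - n) * B r * / n))
    (fun r => - (pw r (n - 1) * v r))); try lra.
  - rewrite pw_nonpos, (rsys_A0 _ _ _ _ _ _ _ sys) by lra. lra.
  - hcont_tac.
  - hcont_tac.
  - intros x Hx. eapply D_eq.
    + apply D_mult; [apply is_derive_pw; lra|].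
      apply D_mult; [apply D_opp, dv; lra | apply D_const].
    + cbv beta. field; lra.
  - intros x Hx. apply D_opp, dA; lra.
  - intros x Hx. assert (0 <= pw x n * (pw x (1 - n) * B x * / n)); [|lra].
    repeat apply Rmult_le_pos; try apply pw_ge0.
    + apply (rsys_B_pos _ _ _ _ _ _ _ sys); lra.
    + left; apply Rinv_0_lt_compat; lra.
Qed.

(** The decay of [u] in terms of the mass [B]: a constant slope for n = 3, a logarithmic rate for n
    = 4, and with [rsys_B_ge] an inequality closed in [u]. *)
Lemma rsys_du_le r : 0 < r ->
  pw r (1 - n) * A r <= - (pw r (3 - n) * (B r * / (n * (n - 2)))).
Proof.
  intros Hr. pose proof (rsys_A_le r Hr) as H1. pose proof (rsys_v_le r Hr) as H2.
  assert (H3 : pw r (1 - n) * (pw r n * (- v r * / n)) <= pw r (1 - n) * - A r).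
  { apply Rmult_le_compat_l; [apply pw_ge0 | assumption]. }
  assert (H4 : pw r 1 * / n * (pw r (2 - n) * (B r * / (n - 2))) <= pw r 1 * / n * - v r).
  { apply Rmult_le_compat_l; [|assumption].
    apply Rmult_le_pos; [apply pw_ge0 | left; apply Rinv_0_lt_compat; lra]. }
  replace (pw r (1 - n) * (pw r n * (- v r * / n)))
    with (pw r (1 - n) * pw r n * / n * - v r) in H3 by ring.
  rewrite pw_add in H3 by assumption. replace (1 - n + n) with 1 in H3 by ring.
  replace (pw r (3 - n)) with (pw r 1 * pw r (2 - n));
    [|rewrite pw_add by assumption; f_equal; ring].
  replace (pw r 1 * pw r (2 - n) * (B r * / (n * (n - 2))))
    with (pw r 1 * / n * (pw r (2 - n) * (B r * / (n - 2)))) by (field; lra).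
  lra.
Qed.

(** With - u' >= c r^(3+alpha) e^u the derivative of e^(-u) is at least c r^(3+alpha); integrate
    from 0. *)
Lemma rsys_exp_bound : exists C, 0 < C /\
  forall r, 0 < r -> pw r (4 + alpha) * exp (u r) <= C.
Proof.
  set (c := / (n * (n - 2)) * / (n + alpha)).
  assert (Hc : 0 < c).
  { unfold c. apply Rmult_lt_0_compat; apply Rinv_0_lt_compat; nra. }
  exists ((4 + alpha) / c). split; [apply Rdiv_lt_0_compat; lra|].
  intros r Hr.
  assert (H : c / (4 + alpha) * pw r (4 + alpha) <= exp (- u r)).
  { apply Rle_trans with (1 + c / (4 + alpha) * pw r (4 + alpha)); [lra|].
    apply (le_half (fun r => 1 + c / (4 + alpha) * pw r (4 + alpha)) (fun r => exp (- u r))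
      (fun r => c * pw r (3 + alpha)) (fun r => - (pw r (1 - n) * A r) * exp (- u r)));
      try lra.
    - rewrite pw_nonpos, (rsys_u0 _ _ _ _ _ _ _ sys), Ropp_0, exp_0 by lra. lra.
    - hcont_tac.
    - hcont_tac.
    - intros x Hx. D. replace (4 + alpha - 1) with (3 + alpha) by ring. field; lra.
    - intros x Hx. apply (D_exp (fun r => - u r)), D_opp, du; lra.
    - intros x [Hx _]. pose proof (rsys_du_le x Hx) as H1.
      pose proof (rsys_B_ge x Hx) as H2.
      assert (H3 : pw x (3 - n) * (exp (u x) * (pw x (n + alpha) * / (n + alpha))
                     * / (n * (n - 2)))
                   <= pw x (3 - n) * (B x * / (n * (n - 2)))).
      { apply Rmult_le_compat_l; [apply pw_ge0|]. apply Rmult_le_compat_r; [|assumption].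
        left; apply Rinv_0_lt_compat; nra. }
      replace (pw x (3 - n) * (exp (u x) * (pw x (n + alpha) * / (n + alpha))
                     * / (n * (n - 2))))
        with (c * (pw x (3 - n) * pw x (n + alpha)) * exp (u x)) in H3
        by (unfold c; ring).
      rewrite pw_add in H3 by assumption.
      replace (3 - n + (n + alpha)) with (3 + alpha) in H3 by ring.
      rewrite exp_Ropp. pose proof (exp_pos (u x)) as He.
      apply Rmult_le_reg_r with (exp (u x)); [assumption|].
      replace (- (pw x (1 - n) * A x) * / exp (u x) * exp (u x))
        with (- (pw x (1 - n) * A x)) by (field; lra).
      lra. }
  rewrite exp_Ropp in H. pose proof (exp_pos (u r)) as He.
  apply Rmult_le_compat_r with (r := exp (u r)) in H; [|lra].
  rewrite Rinv_l in H by lra.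
  apply Rmult_le_reg_r with (c / (4 + alpha)); [apply Rdiv_lt_0_compat; lra|].
  replace ((4 + alpha) / c * (c / (4 + alpha))) with 1 by (field; lra). lra.
Qed.

(** Here v -> 0 enters: - v r is the integral of v' over (r, oo), and v' <= K s^(-3). In the proof,
    v + K s^(-2) / 2 is nonincreasing with limit 0. *)
Lemma rsys_v_ge K r : 0 <= K -> 0 < r ->
  (forall s, r <= s -> B s <= K * pw s (n - 4)) -> - v r <= K / 2 * pw r (-2).
Proof.
  intros HK Hr HB.
  assert (0 <= v r + K / 2 * pw r (-2)); [|lra].
  apply (lim_le v 0 _ r Hv). intros s Hs.
  assert (- (v r + K / 2 * pw r (-2)) <= - (v s + K / 2 * pw s (-2))).
  { apply (incr_pos (fun s => - (v s + K / 2 * pw s (-2)))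
      (fun s => - (pw s (1 - n) * B s - K * pw s (-3))) r s Hs).
    - intros x Hx. eapply D_eq.
      + apply D_opp, D_plus; [apply dv; lra|].
        apply D_mult; [apply D_const | apply is_derive_pw; lra].
      + cbv beta. replace (-2 - 1) with (-3) by ring. field.
    - intros x Hx. pose proof (HB x (proj1 Hx)) as H.
      apply (Rmult_le_compat_l (pw x (1 - n))) in H; [|apply pw_ge0].
      replace (pw x (1 - n) * (K * pw x (n - 4)))
        with (K * (pw x (1 - n) * pw x (n - 4))) in H by ring.
      rewrite pw_add in H by lra. replace (1 - n + (n - 4)) with (-3) in H by ring.
      lra. }
  pose proof (pw_ge0 s (-2)). nra.
Qed.

Lemma rsys_A_ge K r : 0 <= K -> 0 < r ->
  (forall s, 0 < s -> B s <= K * pw s (n - 4)) ->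
  - A r <= K / 2 * (pw r (n - 2) * / (n - 2)).
Proof.
  intros HK Hr HB.
  apply (le_half (fun r => - A r) (fun r => K / 2 * (pw r (n - 2) * / (n - 2)))
    (fun r => - (pw r (n - 1) * v r)) (fun r => K / 2 * pw r (n - 3))); try lra.
  - rewrite pw_nonpos, (rsys_A0 _ _ _ _ _ _ _ sys) by lra. lra.
  - hcont_tac.
  - hcont_tac.
  - intros x Hx. apply D_opp, dA; lra.
  - intros x Hx. D. replace (n - 2 - 1) with (n - 3) by ring. field; lra.
  - intros x [Hx _].
    assert (H : - v x <= K / 2 * pw x (-2)).
    { apply rsys_v_ge; auto. intros s Hs. apply HB; lra. }
    apply (Rmult_le_compat_l (pw x (n - 1))) in H; [|apply pw_ge0].
    replace (pw x (n - 1) * (K / 2 * pw x (-2)))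
      with (K / 2 * (pw x (n - 1) * pw x (-2))) in H by ring.
    rewrite pw_add in H by lra. replace (n - 1 + -2) with (n - 3) in H by ring. lra.
Qed.

End Estimates.

(** * Emden-Fowler variables *)

(* With [r = e^t]: [w = u + (4+alpha) t], [y = - r u'], [z = - r^2 Delta u],
   [p = r^3 (Delta u)']. *)
Definition efw (alpha : R) (u : R -> R) t := u (exp t) + (4 + alpha) * t.
Definition efy (n : R) (A : R -> R) t := - (exp ((2 - n) * t) * A (exp t)).
Definition efz (v : R -> R) t := - (exp (2 * t) * v (exp t)).
Definition efp (n : R) (B : R -> R) t := exp ((4 - n) * t) * B (exp t).

Record efsys (n alpha : R) (w y z p : R -> R) : Prop := {
  ef_w : forall t, is_derive w t (4 + alpha - y t);
  ef_y : forall t, is_derive y t (z t - (n - 2) * y t);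
  ef_z : forall t, is_derive z t (2 * z t - p t);
  ef_p : forall t, is_derive p t (exp (w t) - (n - 4) * p t) }.

Lemma rsys_efsys n alpha beta u v A B : rsys n alpha beta u v A B ->
  efsys n alpha (efw alpha u) (efy n A) (efz v) (efp n B).
Proof.
  intros sys.
  assert (DE : forall (f : R -> R) df t, is_derive f (exp t) df ->
    is_derive (fun t => f (exp t)) t (exp t * df)).
  { intros f df t H. apply D_comp; [assumption | apply is_derive_exp]. }
  assert (DL : forall c t, is_derive (fun t => exp (c * t)) t (c * exp (c * t))).
  { intros c t. D. ring. }
  constructor; intros t.
  - unfold efw, efy. eapply D_eq.
    + apply D_plus; [apply DE, (rsys_du _ _ _ _ _ _ _ sys), exp_pos|].
      apply D_mult; [apply D_const | apply D_id].
    + rewrite pw_exp.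
      replace (exp ((2 - n) * t)) with (exp t * exp ((1 - n) * t))
        by (rewrite <- exp_plus; f_equal; ring).
      ring.
  - unfold efz, efy. eapply D_eq.
    + apply D_opp, D_mult; [apply DL | apply DE, (rsys_dA _ _ _ _ _ _ _ sys), exp_pos].
    + rewrite pw_exp.
      replace (exp (2 * t)) with (exp ((2 - n) * t) * exp t * exp ((n - 1) * t))
        by (rewrite <- !exp_plus; f_equal; ring).
      ring.
  - unfold efz, efp. eapply D_eq.
    + apply D_opp, D_mult; [apply DL | apply DE, (rsys_dv _ _ _ _ _ _ _ sys), exp_pos].
    + rewrite pw_exp.
      replace (exp ((4 - n) * t)) with (exp (2 * t) * exp t * exp ((1 - n) * t))
        by (rewrite <- !exp_plus; f_equal; ring).
      ring.
  - unfold efw, efp. eapply D_eq.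
    + apply D_mult; [apply DL | apply DE, (rsys_dB _ _ _ _ _ _ _ sys), exp_pos].
    + rewrite pw_exp, exp_plus.
      replace (exp ((4 + alpha) * t))
        with (exp ((4 - n) * t) * exp t * exp ((n - 1 + alpha) * t))
        by (rewrite <- !exp_plus; f_equal; ring).
      ring.
Qed.

(* [w' w''' - w''^2/2 + a3 w' w'' + a2 w'^2/2 - e^w + kappa w] for the equation
   [w'''' + a3 w''' + a2 w'' + a1 w' = e^w - kappa]. *)
Definition energy (n alpha w y z p : R) : R :=
  (4 + alpha - y) * (p + (n - 4) * z - (n - 2) ^ 2 * y)
  - (z - (n - 2) * y) ^ 2 / 2
  - (2 * n - 8) * ((4 + alpha - y) * (z - (n - 2) * y))
  + (n ^ 2 - 10 * n + 20) * ((4 + alpha - y) ^ 2 / 2)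
  - exp w + 2 * (4 + alpha) * (n - 2) * (n - 4) * w.

(** Multiplying the equation by w' leaves a3 w''^2 - a1 w'^2, with a3 = 2 (n - 4) and a1 = - 2 (n -
    2) (n - 4). *)
Lemma is_derive_energy n alpha w y z p t : efsys n alpha w y z p ->
  is_derive (fun t => energy n alpha (w t) (y t) (z t) (p t)) t
    ((2 * n - 8) * (z t - (n - 2) * y t) ^ 2
     + 2 * (n - 4) * (n - 2) * (4 + alpha - y t) ^ 2).
Proof.
  intros [Hw Hy Hz Hp]. unfold energy, Rdiv. D. simpl. field.
Qed.

(** Barbalat: on a window of length tau the increment of [f] is small, so [g] is small at some point
    of it, and [g] varies by at most C' tau = e / 4 across the window. *)
Lemma lim_derive (f g h : R -> R) (C l : R) :
  (forall t, is_derive f t (g t)) -> (forall t, is_derive g t (h t)) ->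
  (forall t, 0 <= t -> Rabs (h t) <= C) -> is_lim f p_infty l -> is_lim g p_infty 0.
Proof.
  intros Df Dg Hb HL. apply lim_infty_intro. intros e He.
  set (C' := Rmax C 0 + 1).
  assert (HC' : C <= C' /\ 0 < C').
  { unfold C'. pose proof (Rmax_l C 0). pose proof (Rmax_r C 0). lra. }
  set (tau := e / (4 * C')).
  assert (Ht : 0 < tau) by (apply Rdiv_lt_0_compat; lra).
  assert (He4 : 0 < e * tau / 4) by (apply Rdiv_lt_0_compat; nra).
  destruct (lim_infty_elim f l HL _ He4) as [M HM].
  exists (Rmax M 0). intros x Hx. rewrite Rminus_0_r.
  assert (Hx1 : M < x) by (eapply Rle_lt_trans; [apply Rmax_l | apply Hx]).
  assert (Hx2 : 0 < x) by (eapply Rle_lt_trans; [apply Rmax_r | apply Hx]).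
  assert (Hx3 : M < x + tau) by lra.
  pose proof (HM x Hx1) as F1. pose proof (HM _ Hx3) as F2.
  destruct (MVT_gen f x (x + tau) g) as [c [Hc Ec]].
  { intros; apply Df. }
  { intros. apply continuity_pt_filterlim, (ex_derive_continuous f). eexists; apply Df. }
  rewrite Rmin_left, Rmax_right in Hc by lra.
  destruct (MVT_gen g x c h) as [c2 [Hc2 Ec2]].
  { intros; apply Dg. }
  { intros. apply continuity_pt_filterlim, (ex_derive_continuous g). eexists; apply Dg. }
  rewrite Rmin_left, Rmax_right in Hc2 by lra.
  assert (Hc20 : 0 <= c2) by lra. specialize (Hb c2 Hc20).
  assert (G1 : Rabs (g c) < e / 2).
  { apply Rmult_lt_reg_r with tau; [assumption|].
    rewrite <- (Rabs_pos_eq tau) at 1 by lra. rewrite <- Rabs_mult.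
    replace (g c * tau) with (f (x + tau) - l - (f x - l)) by lra.
    eapply Rle_lt_trans; [apply Rabs_triang|]. rewrite Rabs_Ropp. lra. }
  assert (G2 : Rabs (g c - g x) <= e / 4).
  { rewrite Ec2, Rabs_mult, (Rabs_pos_eq (c - x)) by lra.
    apply Rle_trans with (C' * tau).
    - apply Rmult_le_compat; try lra. apply Rabs_pos.
    - right. unfold tau. field. lra. }
  replace (g x) with (g c - (g c - g x)) by ring.
  eapply Rle_lt_trans; [apply Rabs_triang|]. rewrite Rabs_Ropp. lra.
Qed.

(** * Rules for finite limits *)

Lemma lim_plus (f g : R -> R) (x : Rbar) (a b : R) : is_lim f x a -> is_lim g x b ->
  is_lim (fun t => f t + g t) x (a + b).
Proof. intros. now apply (is_lim_plus f g x a b). Qed.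

Lemma lim_minus (f g : R -> R) (x : Rbar) (a b : R) : is_lim f x a -> is_lim g x b ->
  is_lim (fun t => f t - g t) x (a - b).
Proof. intros. now apply (is_lim_minus f g x a b). Qed.

Lemma lim_mult (f g : R -> R) (x : Rbar) (a b : R) : is_lim f x a -> is_lim g x b ->
  is_lim (fun t => f t * g t) x (a * b).
Proof. intros. now apply (is_lim_mult f g x a b). Qed.

Lemma lim_const (c : R) (x : Rbar) : is_lim (fun _ => c) x c.
Proof. apply is_lim_const. Qed.

Lemma lim_val (f : R -> R) (x : Rbar) (a b : R) : is_lim f x a -> a = b -> is_lim f x b.
Proof. now intros H <-. Qed.

Ltac lim_tac := repeat first [ eassumption |
  lazymatch goal with
  | |- is_lim (fun _ => ?c) _ _ => apply (lim_const c)
  | |- is_lim (fun t => @?f t + @?g t) _ _ => apply (lim_plus f g)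
  | |- is_lim (fun t => @?f t - @?g t) _ _ => apply (lim_minus f g)
  | |- is_lim (fun t => @?f t * @?g t) _ _ => apply (lim_mult f g)
  | |- is_lim (fun t => ?f t) ?x ?l => change (is_lim f x l)
  end ].

(** * Functions bounded on [0, oo) *)

Definition bdd (f : R -> R) := exists C, forall t, 0 <= t -> Rabs (f t) <= C.

Lemma bdd_const c : bdd (fun _ => c).
Proof. exists (Rabs c). intros; lra. Qed.

Lemma bdd_plus f g : bdd f -> bdd g -> bdd (fun t => f t + g t).
Proof.
  intros [C HC] [D HD]. exists (C + D). intros t Ht.
  eapply Rle_trans; [apply Rabs_triang|]. specialize (HC t Ht). specialize (HD t Ht). lra.
Qed.

Lemma bdd_opp f : bdd f -> bdd (fun t => - f t).
Proof. intros [C HC]. exists C. intros t Ht. rewrite Rabs_Ropp. auto. Qed.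

Lemma bdd_minus f g : bdd f -> bdd g -> bdd (fun t => f t - g t).
Proof. intros Hf Hg. exact (bdd_plus _ _ Hf (bdd_opp _ Hg)). Qed.

Lemma bdd_mult f g : bdd f -> bdd g -> bdd (fun t => f t * g t).
Proof.
  intros [C HC] [D HD]. exists (C * D). intros t Ht.
  rewrite Rabs_mult. apply Rmult_le_compat; auto using Rabs_pos.
Qed.

Lemma bdd_pow f k : bdd f -> bdd (fun t => f t ^ k).
Proof.
  intros Hf. induction k as [|k IH]; simpl; [apply bdd_const | now apply bdd_mult].
Qed.

Ltac bdd_tac := repeat first [ assumption |
  lazymatch goal with
  | |- bdd (fun _ => ?c) => apply (bdd_const c)
  | |- bdd (fun t => @?f t + @?g t) => apply (bdd_plus f g)
  | |- bdd (fun t => @?f t - @?g t) => apply (bdd_minus f g)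
  | |- bdd (fun t => @?f t * @?g t) => apply (bdd_mult f g)
  | |- bdd (fun t => @?f t / ?c) => apply (bdd_mult f (fun _ => / c))
  | |- bdd (fun t => - @?f t) => apply (bdd_opp f)
  | |- bdd (fun t => @?f t ^ ?k) => apply (bdd_pow f k)
  | |- bdd (fun t => ?f t) => change (bdd f)
  end ].

Lemma lim_derive_bdd (f g h : R -> R) (l : R) :
  (forall t, is_derive f t (g t)) -> (forall t, is_derive g t (h t)) ->
  bdd h -> is_lim f p_infty l -> is_lim g p_infty 0.
Proof. intros Df Dg [C HC]. now apply (lim_derive f g h C). Qed.

(** * Dimension at least five *)

Lemma efsys_lim n alpha w y z p : 4 < n -> -2 < alpha -> efsys n alpha w y z p ->
  bdd y -> bdd z -> bdd p -> bdd (fun t => exp (w t)) ->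
  is_lim w p_infty (ln (2 * (4 + alpha) * (n - 2) * (n - 4))).
Proof.
  intros Hn Ha sys by_ bz bp be. destruct sys as [Hw Hy Hz Hp] eqn:Esys. clear Esys.
  set (k := 2 * (4 + alpha) * (n - 2) * (n - 4)).
  assert (Hk : 0 < k).
  { unfold k. repeat apply Rmult_lt_0_compat; lra. }
  set (H := fun t => energy n alpha (w t) (y t) (z t) (p t)).
  set (H1 := fun t => (2 * n - 8) * (z t - (n - 2) * y t) ^ 2
     + 2 * (n - 4) * (n - 2) * (4 + alpha - y t) ^ 2).
  assert (DH : forall t, is_derive H t (H1 t)) by (intros; now apply is_derive_energy).
  assert (H1_ge : forall t, 2 * (n - 4) * (n - 2) * (4 + alpha - y t) ^ 2 <= H1 t).
  { intros t. unfold H1. pose proof (pow2_ge_0 (z t - (n - 2) * y t)). nra. }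
  assert (H1_pos : forall t, 0 <= H1 t).
  { intros t. eapply Rle_trans; [|apply H1_ge].
    apply Rmult_le_pos; [nra | apply pow2_ge_0]. }
  (* All of the energy except k w is bounded. As k > 0 and [w] is bounded above, [H] is bounded
     above; being nondecreasing, it converges, and Barbalat yields H' -> 0. *)
  assert (bR : bdd (fun t => H t - k * w t)).
  { assert (X : bdd (fun t => energy n alpha (w t) (y t) (z t) (p t) - k * w t + 0)).
    2:{ destruct X as [C HC]. exists C. intros t Ht. specialize (HC t Ht).
        unfold H. now rewrite Rplus_0_r in HC. }
    destruct (bdd_plus (fun t => (4 + alpha - y t) * (p t + (n - 4) * z t - (n - 2) ^ 2 * y t)
      - (z t - (n - 2) * y t) ^ 2 / 2
      - (2 * n - 8) * ((4 + alpha - y t) * (z t - (n - 2) * y t))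
      + (n ^ 2 - 10 * n + 20) * ((4 + alpha - y t) ^ 2 / 2)) (fun t => - exp (w t)))
      as [C HC].
    - bdd_tac.
    - bdd_tac.
    - exists C. intros t Ht. specialize (HC t Ht).
      replace (energy n alpha (w t) (y t) (z t) (p t) - k * w t + 0) with
        ((4 + alpha - y t) * (p t + (n - 4) * z t - (n - 2) ^ 2 * y t)
      - (z t - (n - 2) * y t) ^ 2 / 2
      - (2 * n - 8) * ((4 + alpha - y t) * (z t - (n - 2) * y t))
      + (n ^ 2 - 10 * n + 20) * ((4 + alpha - y t) ^ 2 / 2) + - exp (w t));
        [exact HC | unfold energy, k; ring]. }
  destruct bR as [CR HCR]. destruct be as [Ce HCe].
  assert (Hw_up : forall t, 0 <= t -> w t <= Ce).
  { intros t Ht. specialize (HCe t Ht). pose proof (Rle_abs (exp (w t))).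
    pose proof (exp_ineq1_le (w t)). lra. }
  destruct (lim_incr H 0 (CR + k * Ce)) as [l [Hl [_ Hl2]]].
  { intros s t Hs Ht. apply (incr_pos H H1); auto. }
  { intros t Ht. specialize (HCR t Ht). specialize (Hw_up t Ht).
    apply Rabs_le_between in HCR. nra. }
  assert (LH1 : is_lim H1 p_infty 0).
  { apply (lim_derive_bdd H H1 (fun t =>
      (2 * n - 8) * (2 * (2 * z t - p t - (n - 2) * (z t - (n - 2) * y t))
                     * (z t - (n - 2) * y t))
      + 2 * (n - 4) * (n - 2) * (2 * - (z t - (n - 2) * y t) * (4 + alpha - y t))) l); auto.
    - intros t. unfold H1. D. simpl. ring.
    - bdd_tac. }
  assert (Ly : is_lim y p_infty (4 + alpha)).
  { apply lim_infty_intro. intros e He.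
    set (m := 2 * (n - 4) * (n - 2)).
    assert (Hm : 0 < m) by (unfold m; repeat apply Rmult_lt_0_compat; lra).
    assert (Hme : 0 < m * e ^ 2) by (apply Rmult_lt_0_compat; [assumption | nra]).
    destruct (lim_infty_elim _ _ LH1 _ Hme) as [M HM].
    exists M. intros x Hx. specialize (HM x Hx). rewrite Rminus_0_r in HM.
    rewrite Rabs_pos_eq in HM by apply H1_pos.
    specialize (H1_ge x). fold m in H1_ge.
    assert (H2 : (4 + alpha - y x) ^ 2 < e ^ 2).
    { apply Rmult_lt_reg_l with m; [assumption|]. lra. }
    apply Rabs_def1; nra. }
  assert (by' : bdd (fun t => 2 * z t - p t - (n - 2) * (z t - (n - 2) * y t))) by bdd_tac.
  assert (be : bdd (fun t => exp (w t))) by (exists Ce; assumption).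
  (* A cascade: each of y, z, p converges by the previous stage, so Barbalat sends its derivative to
     0, and that equation of the system gives the limit of the next quantity, up to e^w. *)
  assert (Ly' : is_lim (fun t => z t - (n - 2) * y t) p_infty 0).
  { apply (lim_derive_bdd y _ (fun t => 2 * z t - p t - (n - 2) * (z t - (n - 2) * y t))
      (4 + alpha)); auto. intros t. D. ring. }
  assert (Lz : is_lim z p_infty ((n - 2) * (4 + alpha))).
  { apply is_lim_ext with (fun t => (z t - (n - 2) * y t) + (n - 2) * y t); [intros; ring|].
    eapply lim_val; [apply lim_plus; [apply Ly' | apply lim_mult; [apply lim_const | apply Ly]]|].
    ring. }
  assert (Lz' : is_lim (fun t => 2 * z t - p t) p_infty 0).
  { apply (lim_derive_bdd z _ (fun t => 2 * (2 * z t - p t) - (exp (w t) - (n - 4) * p t))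
      ((n - 2) * (4 + alpha))); auto.
    - intros t. D. ring.
    - bdd_tac. }
  assert (Lp : is_lim p p_infty (2 * ((n - 2) * (4 + alpha)))).
  { apply is_lim_ext with (fun t => 2 * z t - (2 * z t - p t)); [intros; ring|].
    eapply lim_val; [apply lim_minus; [apply lim_mult; [apply lim_const | apply Lz] | apply Lz']|].
    ring. }
  assert (Lp' : is_lim (fun t => exp (w t) - (n - 4) * p t) p_infty 0).
  { apply (lim_derive_bdd p _ (fun t => (4 + alpha - y t) * exp (w t)
      - (n - 4) * (exp (w t) - (n - 4) * p t)) (2 * ((n - 2) * (4 + alpha)))); auto.
    - intros t. D. ring.
    - bdd_tac. }
  assert (Le : is_lim (fun t => exp (w t)) p_infty k).
  { apply is_lim_ext with (fun t => (exp (w t) - (n - 4) * p t) + (n - 4) * p t);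
      [intros; ring|].
    eapply lim_val; [apply lim_plus; [apply Lp' | apply lim_mult; [apply lim_const | apply Lp]]|].
    unfold k; ring. }
  apply is_lim_ext with (fun t => ln (exp (w t))); [intros; apply ln_exp|].
  apply is_lim_comp_continuous; [exact Le|].
  apply (ex_derive_continuous ln). exists (/ k). now apply is_derive_ln.
Qed.

Lemma lim_comp_ln (f : R -> R) (l : R) : is_lim f p_infty l ->
  is_lim (fun r => f (ln r)) p_infty l.
Proof.
  intros H. apply is_lim_comp with p_infty; auto using is_lim_ln_p.
  exists 0. discriminate.
Qed.

(** From r^(4+alpha) e^u <= C one gets B' <= C r^(n-5), integrable at 0 because n > 4. Hence B <= K
    r^(n-4), and then bounds for [v] and [A] of the orders that make p, z and y bounded. *)
Lemma critical_lim_ge5 n alpha beta u v A B : 5 <= n -> -2 < alpha ->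
  rsys n alpha beta u v A B -> is_lim v p_infty 0 ->
  is_lim (fun r => u r + (4 + alpha) * ln r) p_infty
    (ln (2 * (4 + alpha) * (n - 2) * (n - 4))).
Proof.
  intros Hn Ha sys Hv. assert (Hn3 : 3 <= n) by lra.
  destruct (rsys_exp_bound _ _ _ _ _ _ _ Hn3 Ha sys) as [C [HC He]].
  set (K := C / (n - 4)).
  assert (HK : 0 <= K) by (left; apply Rdiv_lt_0_compat; lra).
  assert (HB : forall s, 0 < s -> B s <= K * pw s (n - 4)).
  { intros s Hs. apply (le_half B (fun s => K * pw s (n - 4))
      (fun r => pw r (n - 1 + alpha) * exp (u r)) (fun r => C * pw r (n - 5))); try lra.
    - rewrite pw_nonpos, (rsys_B0 _ _ _ _ _ _ _ sys) by lra. lra.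
    - apply (rsys_B _ _ _ _ _ _ _ sys).
    - hcont_tac.
    - intros; apply (rsys_dB _ _ _ _ _ _ _ sys); lra.
    - intros x Hx. D. replace (n - 4 - 1) with (n - 5) by ring. unfold K. field; lra.
    - intros x [Hx _]. specialize (He x Hx).
      replace (n - 1 + alpha) with (n - 5 + (4 + alpha)) by ring.
      rewrite <- (pw_add x (n - 5)) by assumption.
      pose proof (pw_ge0 x (n - 5)). nra. }
  apply is_lim_ext_loc with (fun r => efw alpha u (ln r)).
  { exists 0. intros r Hr. unfold efw. now rewrite exp_ln. }
  apply lim_comp_ln.
  assert (Hpe : forall t, 0 < exp t) by exact exp_pos.
  apply (efsys_lim n alpha _ (efy n A) (efz v) (efp n B)); try lra.
  - now apply (rsys_efsys n alpha beta).
  - exists (K / 2 * / (n - 2)). intros t _. unfold efy.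
    assert (H0 : A (exp t) <= 0)
      by (apply (rsys_A_nonpos _ _ _ _ _ _ _ Hn3 Ha sys); left; apply exp_pos).
    pose proof (rsys_A_ge _ _ _ _ _ _ _ Hn3 sys Hv K _ HK (Hpe t) HB) as H1.
    rewrite pw_exp in H1. pose proof (exp_pos ((2 - n) * t)) as E.
    rewrite Rabs_pos_eq by nra.
    apply (Rmult_le_compat_l (exp ((2 - n) * t))) in H1; [|lra].
    replace (exp ((2 - n) * t) * (K / 2 * (exp ((n - 2) * t) * / (n - 2))))
      with (exp ((2 - n) * t) * exp ((n - 2) * t) * (K / 2 * / (n - 2))) in H1 by ring.
    rewrite <- exp_plus in H1.
    replace ((2 - n) * t + (n - 2) * t) with 0 in H1 by ring. rewrite exp_0 in H1. lra.
  - exists (K / 2). intros t _. unfold efz.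
    assert (H0 : v (exp t) <= 0)
      by (apply (rsys_v_nonpos _ _ _ _ _ _ _ Hn3 Ha sys); apply exp_pos).
    assert (H1 : - v (exp t) <= K / 2 * pw (exp t) (-2)).
    { apply (rsys_v_ge _ _ _ _ _ _ _ sys Hv); auto. intros s Hs. apply HB.
      pose proof (exp_pos t); lra. }
    rewrite pw_exp in H1. pose proof (exp_pos (2 * t)) as E.
    rewrite Rabs_pos_eq by nra.
    apply (Rmult_le_compat_l (exp (2 * t))) in H1; [|lra].
    replace (exp (2 * t) * (K / 2 * exp (-2 * t)))
      with (exp (2 * t) * exp (-2 * t) * (K / 2)) in H1 by ring.
    rewrite <- exp_plus in H1.
    replace (2 * t + -2 * t) with 0 in H1 by ring. rewrite exp_0 in H1. lra.
  - exists K. intros t _. unfold efp.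
    assert (H0 : 0 <= B (exp t))
      by (apply (rsys_B_pos _ _ _ _ _ _ _ sys); left; apply exp_pos).
    pose proof (HB _ (Hpe t)) as H1.
    rewrite pw_exp in H1. pose proof (exp_pos ((4 - n) * t)) as E.
    rewrite Rabs_pos_eq by nra.
    apply (Rmult_le_compat_l (exp ((4 - n) * t))) in H1; [|lra].
    replace (exp ((4 - n) * t) * (K * exp ((n - 4) * t)))
      with (exp ((4 - n) * t) * exp ((n - 4) * t) * K) in H1 by ring.
    rewrite <- exp_plus in H1.
    replace ((4 - n) * t + (n - 4) * t) with 0 in H1 by ring. rewrite exp_0 in H1. lra.
  - exists C. intros t _. unfold efw. rewrite Rabs_pos_eq by (left; apply exp_pos).
    rewrite exp_plus, Rmult_comm, <- pw_exp. apply He, exp_pos.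
Qed.

(** * Improper integrals *)

Lemma is_RInt_gen_half (f F : R -> R) (l : R) :
  (forall r, 0 <= r -> is_RInt f 0 r (F r)) -> is_lim F p_infty l ->
  is_RInt_gen f (at_point 0) (Rbar_locally p_infty) l.
Proof.
  intros HF HL P HP. specialize (HL P HP). destruct HL as [M HM].
  apply (Filter_prod _ _ _ (fun x => x = 0) (fun y => Rmax M 0 < y)).
  - reflexivity.
  - exists (Rmax M 0). auto.
  - intros x y -> Hy. exists (F y). split.
    + apply HF. pose proof (Rmax_r M 0); simpl; lra.
    + apply HM. pose proof (Rmax_l M 0); lra.
Qed.

Lemma is_RInt_gen_prim a g (f : R -> R) (l : R) : 0 < a -> hcont g ->
  (forall r, 0 < r -> f r = pw r a * g r) -> is_lim (prim a g) p_infty l ->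
  is_RInt_gen f (at_point 0) (Rbar_locally p_infty) l.
Proof.
  intros Ha Hg E HL. apply (is_RInt_gen_half f (prim a g)); [|assumption].
  intros r Hr. apply is_RInt_ext with (fun r => pw r a * g r).
  { intros x Hx. rewrite Rmin_left in Hx by lra. symmetry; apply E; lra. }
  replace (prim a g r) with (prim a g r - prim a g 0) by (rewrite prim_0; ring).
  apply (FTC_half (prim a g)); auto.
  - apply hcont_prim; auto; lra.
  - hcont_tac.
  - intros; apply is_derive_prim; auto; lra.
Qed.

Lemma lim_inv_infty : is_lim (fun r => / r) p_infty 0.
Proof.
  apply lim_infty_intro. intros e He. exists (/ e). intros x Hx.
  assert (0 < / e) by now apply Rinv_0_lt_compat.
  rewrite Rminus_0_r, Rabs_pos_eq by (left; apply Rinv_0_lt_compat; lra).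
  rewrite <- (Rinv_inv e). apply Rinv_lt_contravar; [nra | assumption].
Qed.

Lemma prim_lim_tail a f c D : -1 < a -> 0 < c -> 0 <= D -> hcont f ->
  (forall r, 1 <= r -> 0 <= f r <= D * exp (- c * r)) ->
  exists g C : R, is_lim (prim a f) p_infty g /\ 0 <= C /\
    forall r, 1 <= r -> 0 <= g - prim a f r <= C * exp (- (c / 2) * r).
Proof.
  intros Ha Hc HD Hf Hb.
  destruct (prim_tail a f c D) as [C [HC H]]; auto; [intros; now apply Hb|].
  destruct (lim_incr (prim a f) 1 (prim a f 1 + C)) as [g [Hg [_ Hg2]]].
  - intros x y Hx Hy. apply (incr_pos (prim a f) (fun r => pw r a * f r)); auto.
    + intros; apply is_derive_prim; auto; lra.
    + intros. apply Rmult_le_pos; [apply pw_ge0 | apply Hb; lra].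
  - intros x Hx. specialize (H 1 x (Rle_refl 1) Hx).
    assert (exp (- (c / 2) * 1) <= 1) by (rewrite <- exp_0 at 2; apply exp_le_exp; lra).
    nra.
  - exists g, C. split; [assumption|]. split; [assumption|].
    intros r Hr. specialize (Hg2 r Hr). split; [lra|].
    assert (g <= prim a f r + C * exp (- (c / 2) * r)); [|lra].
    apply (lim_le (prim a f) g _ r Hg). intros x Hx. specialize (H r x Hr Hx). lra.
Qed.

(** * Dimension three *)

Section Dim3.
Variables (alpha beta : R) (u v A B : R -> R).
Hypotheses (Ha : -2 < alpha) (sys : rsys 3 alpha beta u v A B)
  (Hv : is_lim v p_infty 0).

Let eu r := exp (u r).
Let cu := rsys_u _ _ _ _ _ _ _ sys.
(** Moments of r^(1+alpha) e^u, the fourth derivative of r u. At infinity, those of order 1, 2, 3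
    are the three integrals of the statement divided by 4 pi. *)
Let G (k : R) := prim (k + 1 + alpha) eu.

Let hcont_eu : hcont eu.
Proof. now apply hcont_exp. Qed.

Let hcont_G k : 0 <= k -> hcont (G k).
Proof. intros; apply hcont_prim; auto; lra. Qed.

Let is_derive_G k r : 0 <= k -> 0 < r -> is_derive (G k) r (pw r k * (pw r (1 + alpha) * eu r)).
Proof.
  intros Hk Hr. eapply D_eq; [apply is_derive_prim; auto; lra|].
  rewrite <- Rmult_assoc, pw_add by assumption. f_equal. f_equal. ring.
Qed.

Let G_0 k : G k 0 = 0.
Proof. apply prim_0. Qed.

(** Taylor's formula for r v, whose second derivative is r^(1+alpha) e^u in dimension three. *)
Let v_eq r : 0 < r -> r * v r = beta * r + r * G 0 r - G 1 r.
Proof.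
  intros Hr. assert (Hr0 : 0 <= r) by lra. assert (H23 : 2 < 3) by lra.
  destruct (rsys_fixed_point _ _ _ _ _ _ _ H23 Ha sys r Hr0) as [E _].
  rewrite E, invlap_def. fold eu. unfold G.
  replace (2 - 3) with (- (1)) by ring. rewrite pw_inv, pw_one by assumption.
  replace (3 - 1 + alpha) with (1 + 1 + alpha) by ring.
  replace (0 + 1 + alpha) with (1 + alpha) by ring. field; lra.
Qed.

(* Taylor's formula with integral remainder for [r u], whose fourth derivative
   is [r^(1+alpha) e^u]. *)
Let u_eq r : 0 < r -> u r =
  beta * r ^ 2 / 6 + r ^ 2 * G 0 r / 6 - r * G 1 r / 2 + G 2 r / 2 - G 3 r / (6 * r).
Proof.
  intros Hr. assert (Hr0 : 0 <= r) by lra. assert (H23 : 2 < 3) by lra.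
  pose proof (rsys_v _ _ _ _ _ _ _ sys) as cv.
  destruct (rsys_fixed_point _ _ _ _ _ _ _ H23 Ha sys r Hr0) as [_ E].
  assert (c0 : hcont (G 0)) by (apply hcont_G; lra).
  assert (c1 : hcont (G 1)) by (apply hcont_G; lra).
  assert (c2 : hcont (G 2)) by (apply hcont_G; lra).
  assert (c3 : hcont (G 3)) by (apply hcont_G; lra).
  assert (p3 : forall x, 0 < x -> pw x 3 = x ^ 3).
  { intros x Hx. rewrite <- pw_nat by assumption. f_equal. simpl; ring. }
  assert (D0 : forall x, 0 < x -> is_derive (G 0) x (pw x (1 + alpha) * eu x)).
  { intros x Hx. eapply D_eq; [apply is_derive_G; lra|]. rewrite pw_zero by lra. ring. }
  assert (D1 : forall x, 0 < x -> is_derive (G 1) x (x * (pw x (1 + alpha) * eu x))).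
  { intros x Hx. eapply D_eq; [apply is_derive_G; lra|]. now rewrite pw_one by lra. }
  assert (D2 : forall x, 0 < x -> is_derive (G 2) x (x ^ 2 * (pw x (1 + alpha) * eu x))).
  { intros x Hx. eapply D_eq; [apply is_derive_G; lra|]. now rewrite pw_two by lra. }
  assert (D3 : forall x, 0 < x -> is_derive (G 3) x (x ^ 3 * (pw x (1 + alpha) * eu x))).
  { intros x Hx. eapply D_eq; [apply is_derive_G; lra|]. now rewrite p3 by lra. }
  (* In this and the next formula the derivatives of the moments cancel (1 - 2 + 1 and 2 - 3 + 1),
     leaving r v and r (r v). *)
  assert (E1 : prim (1 + 0) v r =
    beta * (r ^ 2 * / 2) + (r ^ 2 * G 0 r - 2 * (r * G 1 r) + G 2 r) * / 2).
  { apply (eq_half _ (fun r => beta * (r ^ 2 * / 2)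
      + (r ^ 2 * G 0 r - 2 * (r * G 1 r) + G 2 r) * / 2) (fun r => pw r (1 + 0) * v r)); auto.
    - rewrite prim_0, !G_0. simpl; ring.
    - apply hcont_prim; auto; lra.
    - hcont_tac.
    - intros; apply is_derive_prim; auto; lra.
    - intros x [Hx _]. replace (1 + 0) with 1 by ring. rewrite pw_one, v_eq by assumption.
      D. simpl. field. }
  assert (E2 : prim (3 - 1 + 0) v r =
    beta * (r ^ 3 * / 3) + (2 * (r ^ 3 * G 0 r) - 3 * (r ^ 2 * G 1 r) + G 3 r) * / 6).
  { apply (eq_half _ (fun r => beta * (r ^ 3 * / 3)
      + (2 * (r ^ 3 * G 0 r) - 3 * (r ^ 2 * G 1 r) + G 3 r) * / 6)
      (fun r => pw r (3 - 1 + 0) * v r)); auto.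
    - rewrite prim_0, !G_0. simpl; ring.
    - apply hcont_prim; auto; lra.
    - hcont_tac.
    - intros; apply is_derive_prim; auto; lra.
    - intros x [Hx _]. replace (3 - 1 + 0) with 2 by ring. rewrite pw_two by assumption.
      replace (x ^ 2 * v x) with (x * (x * v x)) by ring. rewrite v_eq by assumption.
      D. simpl. field. }
  rewrite E, invlap_def, E1, E2.
  replace (2 - 3) with (- (1)) by ring. rewrite pw_inv, pw_one by assumption. field; lra.
Qed.

(** For n = 3 the power in [rsys_du_le] is r^0, so u' <= - B 1 / 3 from r = 1 on. *)
Let eu_decay : exists c D, 0 < c /\ 0 <= D /\
  forall r, 1 <= r -> 0 <= eu r <= D * exp (- c * r).
Proof.
  assert (H33 : 3 <= 3) by lra.
  set (c := B 1 * / (3 * (3 - 2))).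
  assert (HB : 0 < B 1).
  { pose proof (rsys_B_ge _ _ _ _ _ _ _ H33 Ha sys 1 Rlt_0_1) as H.
    eapply Rlt_le_trans; [|apply H].
    repeat apply Rmult_lt_0_compat; [apply exp_pos | apply pw_gt0; lra|].
    apply Rinv_0_lt_compat; lra. }
  assert (Hc : 0 < c) by (unfold c; lra).
  exists c, (exp (u 1 + c)). split; [assumption|]. split; [left; apply exp_pos|].
  intros r Hr. split; [left; apply exp_pos|].
  unfold eu. rewrite <- exp_plus. apply exp_le_exp.
  apply (le_pos u (fun r => u 1 + c + - c * r) (fun r => pw r (1 - 3) * A r) (fun _ => - c) 1 r);
    try lra.
  - intros; apply (rsys_du _ _ _ _ _ _ _ sys); lra.
  - intros x Hx. D. ring.
  - intros x Hx. assert (Hx0 : 0 < x) by lra.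
    pose proof (rsys_du_le _ _ _ _ _ _ _ H33 Ha sys x Hx0) as H.
    replace (3 - 3) with 0 in H by ring. rewrite pw_zero in H by assumption.
    pose proof (rsys_B_mono _ _ _ _ _ _ _ sys 1 x Rlt_0_1 (proj1 Hx)).
    unfold c. lra.
Qed.

Lemma critical_expansion_3 : exists I0 I1 I2 : R,
  is_radial_integral3 (fun r => pw r alpha * exp (u r)) I0 /\
  is_radial_integral3 (fun r => pw r (1 + alpha) * exp (u r)) I1 /\
  is_radial_integral3 (fun r => pw r (2 + alpha) * exp (u r)) I2 /\
  let a1 := - / (8 * PI) * I0 in
  let a2 := / (8 * PI) * I1 in
  let a3 := - / (24 * PI) * I2 in
  exists c : R, 0 < c /\
    exists C M : R, forall r, M <= r ->
      Rabs (u r - (a1 * r + a2 + a3 / r)) <= C * exp (- c * r).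
Proof.
  destruct eu_decay as [c [D [Hc [HD Hdec]]]].
  assert (HG : forall k, 0 <= k -> exists g C : R, is_lim (G k) p_infty g /\ 0 <= C /\
    forall r, 1 <= r -> 0 <= g - G k r <= C * exp (- (c / 2) * r)).
  { intros k Hk. apply (prim_lim_tail (k + 1 + alpha) eu c D); auto; lra. }
  destruct (HG 0) as [g0 [C0 [L0 [HC0 T0]]]]; [lra|].
  destruct (HG 1) as [g1 [C1 [L1 [HC1 T1]]]]; [lra|].
  destruct (HG 2) as [g2 [C2 [L2 [HC2 T2]]]]; [lra|].
  destruct (HG 3) as [g3 [C3 [L3 [HC3 T3]]]]; [lra|].
  (* The condition v -> 0 removes the r^2 term of the Taylor formula. *)
  assert (Hb : beta = - g0).
  { assert (L : is_lim v p_infty (beta + g0 - g1 * 0)).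
    { apply is_lim_ext_loc with (fun r => beta + G 0 r - G 1 r * / r).
      - exists 0. intros r Hr. pose proof (v_eq r Hr).
        apply Rmult_eq_reg_l with r; [|lra]. rewrite H. field; lra.
      - apply lim_minus; [apply lim_plus; [apply lim_const | exact L0]|].
        apply lim_mult; [exact L1 | exact lim_inv_infty]. }
    apply is_lim_unique in L. rewrite (is_lim_unique _ _ _ Hv) in L.
    injection L as L. lra. }
  assert (HI : forall k f (g : R), 1 <= k -> is_lim (G k) p_infty g ->
    (forall r, 0 < r -> f r * r ^ 2 = pw r (k + 1 + alpha) * eu r) ->
    is_radial_integral3 f (4 * PI * g)).
  { intros k f g Hk HL Ef. exists g. split; [|reflexivity].
    apply (is_RInt_gen_prim (k + 1 + alpha) eu); auto. lra. }
  exists (4 * PI * g1), (4 * PI * g2), (4 * PI * g3).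
  assert (Ep : forall r a b, 0 < r -> a + 2 = b ->
    pw r a * exp (u r) * r ^ 2 = pw r b * eu r).
  { intros r a b Hr Eb. rewrite <- pw_two by assumption. unfold eu.
    replace (pw r a * exp (u r) * pw r 2) with (pw r a * pw r 2 * exp (u r)) by ring.
    now rewrite pw_add, Eb by assumption. }
  split; [|split; [|split]].
  - apply (HI 1); auto; [lra|]. intros; apply Ep; lra.
  - apply (HI 2); auto; [lra|]. intros; apply Ep; lra.
  - apply (HI 3); auto; [lra|]. intros; apply Ep; lra.
  (* The moment tails decay at rate c / 2; absorbing the factor r^2 costs c / 4 of it. *)
  - intros a1 a2 a3. exists (c / 4). split; [lra|].
    destruct (pw_le_exp 2 (c / 4)) as [K [HK Hp]]; [lra|].
    exists ((C0 + C1 + C2 + C3) * K), 1. intros r Hr.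
    assert (Hr0 : 0 < r) by lra.
    specialize (T0 r Hr). specialize (T1 r Hr). specialize (T2 r Hr). specialize (T3 r Hr).
    specialize (Hp r Hr). rewrite pw_two in Hp by assumption.
    set (X := exp (- (c / 2) * r)) in *. assert (HX : 0 < X) by apply exp_pos.
    pose proof PI_RGT_0 as HPI.
    (* The error is the Taylor formula with moments replaced by their tails, grouped into two
       nonpositive and two nonnegative terms. *)
    replace (u r - (a1 * r + a2 + a3 / r)) with
      ((- (r ^ 2 * (g0 - G 0 r) * / 6) + - ((g2 - G 2 r) * / 2))
       + (r * (g1 - G 1 r) * / 2 + / r * ((g3 - G 3 r) * / 6))).
    2:{ rewrite (u_eq r Hr0), Hb. unfold a1, a2, a3. field. split; lra. }
    assert (Hir : 0 < / r <= 1).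
    { split; [now apply Rinv_0_lt_compat|]. rewrite <- Rinv_1.
      apply Rinv_le_contravar; lra. }
    assert (Hr2 : 1 <= r ^ 2) by nra. assert (Hrr : r <= r ^ 2) by nra.
    assert (S0 : 0 <= r ^ 2 * (g0 - G 0 r) <= r ^ 2 * (C0 * X)).
    { split; [apply Rmult_le_pos; lra | apply Rmult_le_compat_l; lra]. }
    assert (S1 : 0 <= r * (g1 - G 1 r) <= r ^ 2 * (C1 * X)).
    { split; [apply Rmult_le_pos; lra | apply Rmult_le_compat; lra]. }
    assert (S2 : 0 <= g2 - G 2 r <= r ^ 2 * (C2 * X)).
    { split; [lra|]. rewrite <- (Rmult_1_l (g2 - G 2 r)). apply Rmult_le_compat; lra. }
    assert (S3 : 0 <= / r * ((g3 - G 3 r) * / 6) <= r ^ 2 * (C3 * X)).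
    { split; [apply Rmult_le_pos; lra | apply Rmult_le_compat; lra]. }
    assert (S4 : r ^ 2 * X <= K * exp (- (c / 4) * r)).
    { apply Rle_trans with (K * exp (c / 4 * r) * X).
      - apply Rmult_le_compat_r; lra.
      - right. unfold X. rewrite Rmult_assoc, <- exp_plus. f_equal. f_equal. field. }
    assert (S5 : (C0 + C1 + C2 + C3) * (r ^ 2 * X)
                 <= (C0 + C1 + C2 + C3) * (K * exp (- (c / 4) * r))).
    { apply Rmult_le_compat_l; lra. }
    apply Rabs_le. lra.
Qed.

End Dim3.

(** * Dimension four *)

Lemma lim_comp_exp (f : R -> R) (l : R) : is_lim f p_infty l ->
  is_lim (fun t => f (exp t)) p_infty l.
Proof.
  intros H. apply is_lim_comp with p_infty; auto using is_lim_exp_p.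
  exists 0. discriminate.
Qed.

Lemma lim_comp_exp_m f : hcont f -> is_lim (fun t => f (exp t)) m_infty (f 0).
Proof.
  intros Hf. apply is_lim_spec. intros e.
  destruct (proj1 (filterlim_locally _ _) (hcont_right f Hf) e) as [d Hd].
  exists (ln d). intros t Ht.
  assert (Et : exp t < d).
  { rewrite <- (exp_ln d) by apply cond_pos. now apply exp_increasing. }
  pose proof (exp_pos t) as Hp.
  apply (Hd (exp t)); [|assumption]. apply ball_R.
  rewrite Rminus_0_r, Rabs_pos_eq; lra.
Qed.

Lemma abs_ln_le r : 0 < r < 1 -> Rabs (ln r) <= pw r (-1).
Proof.
  intros Hr. assert (ln r < 0) by (rewrite <- ln_1; apply ln_increasing; lra).
  rewrite Rabs_left by assumption. rewrite <- ln_Rinv by lra.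
  replace (-1) with (- (1)) by ring. rewrite pw_inv, pw_one by lra.
  assert (0 < / r) by (apply Rinv_0_lt_compat; lra).
  pose proof (ln_le_sub1 (/ r) H0). lra.
Qed.

Section Dim4.
Variables (alpha beta : R) (u v A B : R -> R).
Hypotheses (Ha : -2 < alpha) (sys : rsys 4 alpha beta u v A B)
  (Hv : is_lim v p_infty 0).

Let H34 : 3 <= 4.
Proof. lra. Qed.

Let cu := rsys_u _ _ _ _ _ _ _ sys.
Let cv := rsys_v _ _ _ _ _ _ _ sys.
Let cA := rsys_A _ _ _ _ _ _ _ sys.
Let cB := rsys_B _ _ _ _ _ _ _ sys.
Let du := rsys_du _ _ _ _ _ _ _ sys.
Let dv := rsys_dv _ _ _ _ _ _ _ sys.
Let dA := rsys_dA _ _ _ _ _ _ _ sys.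
Let dB := rsys_dB _ _ _ _ _ _ _ sys.
Let B_pos := rsys_B_pos _ _ _ _ _ _ _ sys.
Let B_mono := rsys_B_mono _ _ _ _ _ _ _ sys.
Let A_nonpos := rsys_A_nonpos _ _ _ _ _ _ _ H34 Ha sys.

Let D_ln x : 0 < x -> is_derive ln x (/ x).
Proof. apply is_derive_ln. Qed.

(* Once [B] is large, [u] decays so fast that [B] stops growing. *)
Let B_bounded : exists K, forall r, 0 < r -> B r <= K.
Proof.
  (* With 8 = n (n - 2), the threshold gives u' <= - (5 + alpha) / r, so that B' is at most a
     constant times r^(-2), which is integrable at infinity. *)
  destruct (Classical_Prop.classic (exists r1, 0 < r1 /\ 8 * (5 + alpha) <= B r1))
    as [[r1 [Hr1 HB1]]|Hno].
  2:{ exists (8 * (5 + alpha)). intros r Hr. apply Rnot_lt_le. intros C.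
      apply Hno. exists r. lra. }
  assert (Hu : forall r, r1 <= r -> u r <= u r1 + (5 + alpha) * (ln r1 - ln r)).
  { intros r Hr.
    apply (le_pos u (fun r => u r1 + (5 + alpha) * (ln r1 - ln r))
      (fun r => pw r (1 - 4) * A r) (fun r => - (5 + alpha) * / r) r1 r); try lra.
    - intros; apply du; lra.
    - intros x Hx. assert (0 < x) by lra. D. ring.
    - intros x Hx. assert (Hx0 : 0 < x) by lra.
      pose proof (rsys_du_le _ _ _ _ _ _ _ H34 Ha sys x Hx0) as H.
      replace (3 - 4) with (- (1)) in H by ring.
      rewrite pw_inv, pw_one in H by assumption.
      pose proof (B_mono r1 x Hr1 (proj1 Hx)) as HB.
      assert (0 < / x) by now apply Rinv_0_lt_compat.
      assert (/ x * (5 + alpha) <= / x * (B x * / (4 * (4 - 2)))).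
      { apply Rmult_le_compat_l; lra. }
      lra. }
  set (C := exp (u r1 + (5 + alpha) * ln r1)).
  assert (HC : 0 < C) by apply exp_pos.
  assert (HB : forall r, r1 <= r -> B r <= B r1 + C * (pw r1 (-1) - pw r (-1))).
  { intros r Hr.
    apply (le_pos B (fun r => B r1 + C * (pw r1 (-1) - pw r (-1)))
      (fun r => pw r (4 - 1 + alpha) * exp (u r)) (fun r => C * pw r (-2)) r1 r); try lra.
    - intros; apply dB; lra.
    - intros x Hx. D. replace (-1 - 1) with (-2) by ring. ring.
    - intros x Hx.
      assert (He : exp (u x) <= C * pw x (- (5 + alpha))).
      { rewrite pw_eq by lra. unfold C, Rpower. rewrite <- exp_plus. apply exp_le_exp.
        specialize (Hu x (proj1 Hx)). lra. }
      apply (Rmult_le_compat_l (pw x (4 - 1 + alpha))) in He; [|apply pw_ge0].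
      eapply Rle_trans; [apply He|]. right.
      replace (-2) with (4 - 1 + alpha + - (5 + alpha)) by ring.
      rewrite <- (pw_add x (4 - 1 + alpha)) by lra. ring. }
  exists (B r1 + C * pw r1 (-1)). intros r Hr.
  destruct (Rle_lt_dec r1 r) as [H|H].
  - specialize (HB r H). pose proof (pw_ge0 r (-1)). nra.
  - assert (Hrr : r <= r1) by lra. pose proof (B_mono r r1 Hr Hrr).
    pose proof (pw_ge0 r1 (-1)). nra.
Qed.

Let B_lim : exists P : R, is_lim B p_infty P /\ 0 < P /\ forall r, 0 < r -> B r <= P.
Proof.
  destruct B_bounded as [K HK].
  destruct (lim_incr B 1 K) as [P [HP [_ HPle]]].
  - intros x y Hx Hy. apply B_mono; lra.
  - intros; apply HK; lra.
  - exists P. split; [assumption|]. split.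
    + eapply Rlt_le_trans; [|apply (HPle 1); lra].
      eapply Rlt_le_trans; [|apply (rsys_B_ge _ _ _ _ _ _ _ H34 Ha sys 1); lra].
      repeat apply Rmult_lt_0_compat; [apply exp_pos | apply pw_gt0; lra|].
      apply Rinv_0_lt_compat; lra.
    + intros r Hr. destruct (Rle_lt_dec 1 r) as [H|H]; [now apply HPle|].
      apply Rle_trans with (B 1); [apply B_mono; lra | apply HPle; lra].
Qed.

Let v_ge_beta r : 0 <= r -> beta <= v r.
Proof.
  intros Hr. rewrite <- (rsys_v0 _ _ _ _ _ _ _ sys).
  apply (incr_half v (fun r => pw r (1 - 4) * B r)); auto.
  - intros; apply dv; lra.
  - intros. apply Rmult_le_pos; [apply pw_ge0 | apply B_pos; lra].
Qed.

(** In the variables below this is 2 y <= z, that is y' >= 0. The derivative of r^4 (- v) / 2 is - 2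
    r^3 v - r B / 2, and r B / 2 <= - r^3 v by [rsys_v_le]. *)
Let A_ge_v r : 0 < r -> - A r <= pw r 4 * (- v r * / 2).
Proof.
  intros Hr.
  apply (le_half (fun r => - A r) (fun r => pw r 4 * (- v r * / 2))
    (fun r => - (pw r (4 - 1) * v r))
    (fun r => - (2 * (pw r (4 - 1) * v r)) - pw r 4 * pw r (1 - 4) * (B r * / 2))); try lra.
  - rewrite pw_nonpos, (rsys_A0 _ _ _ _ _ _ _ sys) by lra. lra.
  - hcont_tac.
  - hcont_tac.
  - intros x Hx. apply D_opp, dA; lra.
  - intros x Hx. eapply D_eq.
    + apply D_mult; [apply is_derive_pw; lra|].
      apply D_mult; [apply D_opp, dv; lra | apply D_const].
    + cbv beta. field.
  - intros x [Hx _].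
    pose proof (rsys_v_le _ _ _ _ _ _ _ H34 Ha sys x Hx) as H.
    apply (Rmult_le_compat_l (pw x (4 - 1))) in H; [|apply pw_ge0].
    rewrite <- Rmult_assoc, pw_add in H by assumption.
    rewrite pw_add by assumption.
    replace (4 - 1 + (2 - 4)) with (4 + (1 - 4)) in H by ring.
    replace (4 - 2) with 2 in H by ring. lra.
Qed.

Let B_le_pw r : 0 < r -> B r <= / (4 + alpha) * pw r (4 + alpha).
Proof.
  intros Hr.
  apply (le_half B (fun r => / (4 + alpha) * pw r (4 + alpha))
    (fun r => pw r (4 - 1 + alpha) * exp (u r)) (fun r => pw r (4 - 1 + alpha))); try lra.
  - rewrite pw_nonpos, (rsys_B0 _ _ _ _ _ _ _ sys) by lra. lra.
  - assumption.
  - hcont_tac.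
  - intros; apply dB; lra.
  - intros x Hx. D. replace (4 + alpha - 1) with (4 - 1 + alpha) by ring. field; lra.
  - intros x Hx. assert (Hx0 : 0 <= x) by lra.
    assert (exp (u x) <= 1).
    { rewrite <- exp_0. apply exp_le_exp.
      now apply (rsys_u_nonpos _ _ _ _ _ _ _ H34 Ha sys). }
    pose proof (pw_ge0 x (4 - 1 + alpha)). nra.
Qed.

Let continuous_ln x : 0 < x -> continuous ln x.
Proof. intros Hx. apply (ex_derive_continuous ln). eexists; now apply D_ln. Qed.

Let hcont_lnB : hcont (fun r => ln r * B r).
Proof.
  apply (hcont_squeeze _ (/ (4 + alpha)) (3 + alpha)); [lra| | |].
  - rewrite (rsys_B0 _ _ _ _ _ _ _ sys). ring.
  - intros r Hr. apply (continuous_mult ln B); [now apply continuous_ln|].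
    now apply hcont_continuous.
  - intros r Hr. rewrite Rabs_mult, (Rabs_pos_eq (B r)) by (apply B_pos; lra).
    apply Rle_trans with (pw r (-1) * (/ (4 + alpha) * pw r (4 + alpha))).
    + apply Rmult_le_compat; [apply Rabs_pos | apply B_pos; lra | now apply abs_ln_le|].
      apply B_le_pw; lra.
    + right. replace (3 + alpha) with (-1 + (4 + alpha)) by ring.
      rewrite <- (pw_add r (-1)) by lra. ring.
Qed.

(** [A_ge_v] and v >= beta bound the product by - beta r^2 / 2 near 0. *)
Let hcont_Y : hcont (fun r => pw r (-2) * A r).
Proof.
  apply (hcont_squeeze _ (- beta / 2) 2); [lra| | |].
  - rewrite (rsys_A0 _ _ _ _ _ _ _ sys). ring.
  - intros r Hr. apply (continuous_mult (fun r => pw r (-2)) A).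
    + apply (ex_derive_continuous (fun r => pw r (-2))). eexists; now apply is_derive_pw.
    + now apply hcont_continuous.
  - intros r [Hr _]. assert (Hr0 : 0 <= r) by lra.
    rewrite Rabs_mult, (Rabs_pos_eq (pw r (-2))), Rabs_left1
      by (apply pw_ge0 || now apply A_nonpos).
    apply Rle_trans with (pw r (-2) * (pw r 4 * (- v r * / 2))).
    + apply Rmult_le_compat_l; [apply pw_ge0 | now apply A_ge_v].
    + rewrite <- Rmult_assoc, pw_add by assumption.
      replace (-2 + 4) with 2 by ring. rewrite Rmult_comm.
      apply Rmult_le_compat_r; [apply pw_ge0|]. pose proof (v_ge_beta r Hr0). lra.
Qed.

(** Closed form of the logarithmic moment, from repeated integration by parts: ln r B' = (ln r B)' -
    B / r with B / r = r^2 v' = (r^2 v)' - 2 r v and r v = (r^(-2) A)' + 2 u'. The term 4 u is what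
    ties the integral to the asymptotics. *)
Let J r := ln r * B r + 4 * u r + 2 * (pw r (-2) * A r) - r ^ 2 * v r.

Let hcont_J : hcont J.
Proof.
  apply hcont_minus; [|hcont_tac].
  apply hcont_plus; [|apply hcont_mult; [apply hcont_const | apply hcont_Y]].
  apply hcont_plus; [apply hcont_lnB | hcont_tac].
Qed.

Let J_0 : J 0 = 0.
Proof.
  unfold J. rewrite (rsys_B0 _ _ _ _ _ _ _ sys), (rsys_u0 _ _ _ _ _ _ _ sys),
    (rsys_A0 _ _ _ _ _ _ _ sys). ring.
Qed.

Let is_derive_J r : 0 < r -> is_derive J r (pw r (3 + alpha) * exp (u r) * ln r).
Proof.
  intros Hr. unfold J. eapply D_eq.
  - apply D_minus; [apply D_plus; [apply D_plus|]|].
    + apply D_mult; [now apply D_ln | now apply dB].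
    + apply D_mult; [apply D_const | now apply du].
    + apply D_mult; [apply D_const|]. apply D_mult; [now apply is_derive_pw | now apply dA].
    + apply D_mult; [apply D_pow, D_id | now apply dv].
  - replace (-2 - 1) with (-3) by ring. replace (1 - 4) with (-3) by ring.
    replace (4 - 1 + alpha) with (3 + alpha) by ring. replace (4 - 1) with 3 by ring.
    replace (pw r 3) with (r ^ 3) by (rewrite <- pw_nat by assumption; f_equal; simpl; ring).
    replace (-3) with (- (3)) by ring. replace (-2) with (- (2)) by ring.
    rewrite !pw_inv by assumption.
    replace (pw r 3) with (r ^ 3) by (rewrite <- pw_nat by assumption; f_equal; simpl; ring).
    rewrite pw_two by assumption. simpl. field; lra.
Qed.

Let w := efw alpha u.
Let y := efy 4 A.
Let z := efz v.
Let p := efp 4 B.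

Let es : efsys 4 alpha w y z p.
Proof. now apply (rsys_efsys 4 alpha beta). Qed.

Let p_eq t : p t = B (exp t).
Proof. unfold p, efp. replace ((4 - 4) * t) with 0 by ring. rewrite exp_0. ring. Qed.

Let y_eq t : y t = - (pw (exp t) (-2) * A (exp t)).
Proof. unfold y, efy. rewrite pw_exp. replace (2 - 4) with (-2) by ring. reflexivity. Qed.

Let z_eq t : z t = - (exp t ^ 2 * v (exp t)).
Proof.
  unfold z, efz. replace (exp (2 * t)) with (exp t ^ 2); [reflexivity|].
  simpl. rewrite Rmult_1_r, <- exp_plus. f_equal; ring.
Qed.

Let ew_eq t : exp (w t) = exp (u (exp t)) * pw (exp t) (4 + alpha).
Proof. unfold w, efw. rewrite exp_plus, pw_exp. reflexivity. Qed.

Let y_bounds t : 0 <= y t <= z t / 2.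
Proof.
  rewrite y_eq, z_eq. pose proof (exp_pos t) as Ht.
  assert (Ht0 : 0 <= exp t) by lra. set (r := exp t) in *.
  pose proof (A_nonpos r Ht0) as HA. pose proof (pw_ge0 r (-2)) as Hp. split; [nra|].
  apply Rle_trans with (pw r (-2) * (pw r 4 * (- v r * / 2))).
  - pose proof (Rmult_le_compat_l _ _ _ Hp (A_ge_v r Ht)). lra.
  - rewrite <- Rmult_assoc, pw_add by assumption.
    replace (-2 + 4) with 2 by ring. rewrite pw_two by assumption. lra.
Qed.

Let z_lower t : p t / 2 <= z t.
Proof.
  rewrite p_eq, z_eq. pose proof (exp_pos t) as Ht. set (r := exp t) in *.
  pose proof (rsys_v_le _ _ _ _ _ _ _ H34 Ha sys r Ht) as H.
  replace (2 - 4) with (- (2)) in H by ring. rewrite pw_inv, pw_two in H by assumption.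
  apply (Rmult_le_compat_l (r ^ 2)) in H; [|nra].
  replace (r ^ 2 * (/ r ^ 2 * (B r * / (4 - 2)))) with (B r / 2) in H by (field; lra).
  lra.
Qed.

Let J_eq t : J (exp t) = t * p t + 4 * (w t - (4 + alpha) * t) - (2 * y t - z t).
Proof.
  unfold J. rewrite p_eq, y_eq, z_eq, ln_exp. unfold w, efw. ring.
Qed.

Let is_derive_Jexp t : is_derive (fun t => J (exp t)) t (t * exp (w t)).
Proof.
  eapply D_eq; [apply D_comp; [apply is_derive_J, exp_pos | apply is_derive_exp]|].
  rewrite ew_eq, ln_exp.
  replace (pw (exp t) (4 + alpha)) with (exp t * pw (exp t) (3 + alpha)).
  - ring.
  - rewrite <- (pw_one (exp t)) at 1 by apply exp_pos.
    rewrite pw_add by apply exp_pos. f_equal; ring.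
Qed.

(** The energy at n = 4, where a3 and kappa vanish and a2 = -4. *)
Let H t := (4 + alpha - y t) * (p t - 4 * y t) - (z t - 2 * y t) ^ 2 / 2
  - 2 * (4 + alpha - y t) ^ 2 - exp (w t).

Let is_derive_H t : is_derive H t 0.
Proof.
  apply is_derive_ext with (fun t => energy 4 alpha (w t) (y t) (z t) (p t)).
  - intros s. unfold energy, H. simpl. field.
  - eapply D_eq; [now apply is_derive_energy|]. ring.
Qed.

(** t -> -oo is the origin, where y, z, p and e^w vanish; only w' = 4 + alpha contributes. *)
Let H_m : is_lim H m_infty (- 2 * (4 + alpha) ^ 2).
Proof.
  assert (Lp : is_lim p m_infty 0).
  { apply is_lim_ext with (fun t => B (exp t)); [intros; now rewrite p_eq|].
    rewrite <- (rsys_B0 _ _ _ _ _ _ _ sys). now apply lim_comp_exp_m. }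
  assert (Ly : is_lim y m_infty 0).
  { apply is_lim_ext with (fun t => (fun r => - (pw r (-2) * A r)) (exp t));
      [intros; now rewrite y_eq|].
    eapply lim_val; [apply (lim_comp_exp_m (fun r => - (pw r (-2) * A r))), hcont_opp, hcont_Y|].
    cbv beta. rewrite (rsys_A0 _ _ _ _ _ _ _ sys). ring. }
  assert (Lz : is_lim z m_infty 0).
  { apply is_lim_ext with (fun t => (fun r => - (r ^ 2 * v r)) (exp t));
      [intros; now rewrite z_eq|].
    eapply lim_val; [apply (lim_comp_exp_m (fun r => - (r ^ 2 * v r))); hcont_tac|]. cbv beta. ring. }
  assert (Le : is_lim (fun t => exp (w t)) m_infty 0).
  { apply is_lim_ext with (fun t => (fun r => exp (u r) * pw r (4 + alpha)) (exp t));
      [intros; now rewrite ew_eq|].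
    eapply lim_val; [apply (lim_comp_exp_m (fun r => exp (u r) * pw r (4 + alpha))); hcont_tac|].
    cbv beta.
    rewrite pw_nonpos by lra. ring. }
  apply is_lim_ext with (fun t => (4 + alpha - y t) * (p t - 4 * y t)
    - (z t - 2 * y t) * (z t - 2 * y t) * / 2
    - 2 * ((4 + alpha - y t) * (4 + alpha - y t)) - exp (w t)).
  { intros t. unfold H. simpl. field. }
  eapply lim_val.
  - lim_tac.
  - simpl. ring.
Qed.

Let H_const t : H t = - 2 * (4 + alpha) ^ 2.
Proof.
  assert (E : forall s, H s = H t).
  { assert (I : forall a b, a <= b -> H a = H b).
    { intros a b Hab. apply Rle_antisym.
      - apply (incr_pos H (fun _ => 0)); auto; intros; lra.
      - assert (- H a <= - H b); [|lra].
        apply (incr_pos (fun t => - H t) (fun _ => 0)); auto; try (intros; lra).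
        intros x _. eapply D_eq; [apply D_opp, is_derive_H | ring]. }
    intros s. destruct (Rle_dec s t) as [Hs|Hs]; [now apply I|].
    symmetry. apply I. lra. }
  pose proof H_m as L.
  assert (L2 : is_lim H m_infty (H t)).
  { apply is_lim_ext with (fun _ => H t); [intros; symmetry; apply E | apply lim_const]. }
  apply is_lim_unique in L. apply is_lim_unique in L2. rewrite L in L2.
  now injection L2.
Qed.

Lemma critical_lim_4 : exists I : R,
  is_radial_integral4 (fun r => exp (u r) * pw r alpha * ln r) I /\
  is_lim (fun r => u r + (8 + 2 * alpha) * ln r) p_infty
    (Finite (/ (8 * PI ^ 2) * I)).
Proof.
  destruct B_lim as [P [LP [HP HBP]]].
  destruct es as [Dw Dy Dz Dp].
  assert (Lp : is_lim p p_infty P).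
  { apply is_lim_ext with (fun t => B (exp t)); [intros; now rewrite p_eq|].
    now apply lim_comp_exp. }
  assert (Hp : forall t, 0 <= p t <= P).
  { intros t. rewrite p_eq. split; [apply B_pos; left; apply exp_pos|].
    apply HBP, exp_pos. }
  assert (z_upper : forall t, z t <= P / 2).
  { intros t. rewrite z_eq. pose proof (exp_pos t) as Ht. set (r := exp t) in *.
    assert (Hz : - v r <= P / 2 * pw r (-2)).
    { apply (rsys_v_ge _ _ _ _ _ _ _ sys Hv); try lra. intros s Hs.
      replace (4 - 4) with 0 by ring. rewrite pw_zero, Rmult_1_r by lra. apply HBP; lra. }
    replace (-2) with (- (2)) in Hz by ring. rewrite pw_inv, pw_two in Hz by assumption.
    apply (Rmult_le_compat_l (r ^ 2)) in Hz; [|nra].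
    replace (r ^ 2 * (P / 2 * / r ^ 2)) with (P / 2) in Hz by (field; lra). lra. }
  assert (Lz : is_lim z p_infty (P / 2)).
  { apply is_lim_le_le_loc with (fun t => p t * / 2) (fun _ => P / 2).
    - exists 0. intros t _. split; [apply z_lower | apply z_upper].
    - eapply lim_val; [apply lim_mult; [apply Lp | apply lim_const] | field].
    - apply lim_const. }
  assert (bp : bdd p).
  { exists P. intros t _. specialize (Hp t). rewrite Rabs_pos_eq; lra. }
  assert (bz : bdd z).
  { exists (P / 2). intros t _. specialize (z_upper t). pose proof (y_bounds t).
    rewrite Rabs_pos_eq; lra. }
  assert (b_y : bdd y).
  { exists (P / 4). intros t _. specialize (z_upper t). pose proof (y_bounds t).
    rewrite Rabs_pos_eq; lra. }
  assert (be : bdd (fun t => exp (w t))).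
  { destruct (rsys_exp_bound _ _ _ _ _ _ _ H34 Ha sys) as [C [HC He]].
    exists C. intros t _. rewrite Rabs_pos_eq by (left; apply exp_pos).
    rewrite ew_eq, Rmult_comm. apply He, exp_pos. }
  (* [y] is nondecreasing and bounded, hence converges; Barbalat then gives z - 2 y -> 0, which
     identifies the limit as P / 4. *)
  destruct (lim_incr y 0 (P / 4)) as [Y [LY _]].
  { intros s t _ Hst. apply (incr_pos y (fun t => z t - (4 - 2) * y t)); auto.
    intros x _. pose proof (y_bounds x). lra. }
  { intros t _. pose proof (y_bounds t). pose proof (z_upper t). lra. }
  assert (Ly' : is_lim (fun t => z t - (4 - 2) * y t) p_infty 0).
  { apply (lim_derive_bdd y _ (fun t => 2 * z t - p t - (4 - 2) * (z t - (4 - 2) * y t)) Y);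
      auto.
    - intros t. D. ring.
    - bdd_tac. }
  assert (Ly : is_lim y p_infty (P / 4)).
  { apply is_lim_ext with (fun t => / 2 * (z t - (z t - (4 - 2) * y t))); [intros; field|].
    eapply lim_val; [apply lim_mult; [apply lim_const | apply lim_minus; eassumption]|].
    field. }
  (* For n = 4 the derivative of the convergent function [p] is e^w itself. *)
  assert (Le : is_lim (fun t => exp (w t)) p_infty 0).
  { apply is_lim_ext with (fun t => exp (w t) - (4 - 4) * p t); [intros; ring|].
    apply (lim_derive_bdd p _ (fun t => (4 + alpha - y t) * exp (w t)
      - (4 - 4) * (exp (w t) - (4 - 4) * p t)) P); auto.
    - intros t. D. ring.
    - bdd_tac. }
  (* At +oo the energy also reduces to - 2 w'^2, so (4 + alpha - P / 4)^2 = (4 + alpha)^2; the root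
     P = 0 is excluded by P > 0. *)
  assert (HP8 : P = 8 * (4 + alpha)).
  { assert (L : is_lim H p_infty (- 2 * ((4 + alpha - P / 4) * (4 + alpha - P / 4)))).
    { apply is_lim_ext with (fun t => (4 + alpha - y t) * (p t - 4 * y t)
        - (z t - 2 * y t) * (z t - 2 * y t) * / 2
        - 2 * ((4 + alpha - y t) * (4 + alpha - y t)) - exp (w t)).
      { intros t. unfold H. simpl. field. }
      eapply lim_val.
      - lim_tac.
      - field. }
    assert (L2 : is_lim H p_infty (- 2 * (4 + alpha) ^ 2)).
    { apply is_lim_ext with (fun _ => - 2 * (4 + alpha) ^ 2);
        [intros; now rewrite H_const | apply lim_const]. }
    apply is_lim_unique in L. apply is_lim_unique in L2. rewrite L in L2.
    injection L2 as L2.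
    assert (E : P * (P - 8 * (4 + alpha)) = 0) by nra.
    apply Rmult_integral in E. lra. }
  (* Now y -> 4 eta and w' -> - 2 eta, so eventually y >= 3 eta and w' <= - eta. *)
  set (eta := (4 + alpha) / 2). assert (Heta : 0 < eta) by (unfold eta; lra).
  destruct (lim_infty_elim _ _ Ly eta Heta) as [T0 HT0].
  set (T := Rmax T0 0 + 1).
  assert (HT : 0 < T) by (unfold T; pose proof (Rmax_r T0 0); lra).
  assert (Hy : forall t, T <= t -> 3 * eta <= y t).
  { intros t Ht. assert (H1 : T0 < t) by (unfold T in Ht; pose proof (Rmax_l T0 0); lra).
    specialize (HT0 t H1). apply Rabs_def2 in HT0. unfold eta in *. lra. }
  assert (Hw : forall t, T <= t -> w t <= w T + eta * T + - eta * t).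
  { intros t Ht. apply (le_pos w (fun t => w T + eta * T + - eta * t)
      (fun t => 4 + alpha - y t) (fun _ => - eta) T t); auto; try lra.
    - intros x _. D. ring.
    - intros x Hx. specialize (Hy x (proj1 Hx)). unfold eta in *. lra. }
  set (C := exp (w T + eta * T)). assert (HC : 0 < C) by apply exp_pos.
  assert (HJ' : forall t, T <= t -> t * exp (w t) <= C * (2 / eta) * exp (- (eta / 2) * t)).
  { intros t Ht.
    assert (H1 : exp (w t) <= C * exp (- eta * t)).
    { unfold C. rewrite <- exp_plus. apply exp_le_exp. now apply Hw. }
    assert (H2 : t <= 2 / eta * exp (eta / 2 * t)).
    { pose proof (exp_ineq1_le (eta / 2 * t)).
      apply Rle_trans with (2 / eta * (eta / 2 * t)); [right; field; lra|].
      apply Rmult_le_compat_l; [left; apply Rdiv_lt_0_compat; lra | lra]. }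
    apply Rle_trans with (2 / eta * exp (eta / 2 * t) * (C * exp (- eta * t))).
    - apply Rmult_le_compat; try lra. left; apply exp_pos.
    - right. replace (- (eta / 2) * t) with (eta / 2 * t + - eta * t) by field.
      rewrite exp_plus. ring. }
  (* The exponential decay of t e^w makes the logarithmic moment converge. *)
  destruct (lim_incr (fun t => J (exp t)) T
    (J (exp T) + C * (2 / eta) * (2 / eta) * exp (- (eta / 2) * T))) as [Jl [LJ [_ HJl]]].
  { intros s t Hs Hst. apply (incr_pos (fun t => J (exp t)) (fun t => t * exp (w t))); auto.
    intros x Hx. apply Rmult_le_pos; [lra | left; apply exp_pos]. }
  { intros t Ht.
    assert (J (exp t) <= J (exp T) + C * (2 / eta) * (2 / eta)
      * (exp (- (eta / 2) * T) - exp (- (eta / 2) * t))).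
    { apply (le_pos (fun t => J (exp t)) (fun t => J (exp T) + C * (2 / eta) * (2 / eta)
        * (exp (- (eta / 2) * T) - exp (- (eta / 2) * t))) (fun t => t * exp (w t))
        (fun t => C * (2 / eta) * exp (- (eta / 2) * t)) T t); auto; try lra.
      - intros x _. D. field; lra.
      - intros x Hx. apply HJ'; lra. }
    assert (0 < C * (2 / eta) * (2 / eta)).
    { repeat apply Rmult_lt_0_compat; try lra; apply Rinv_0_lt_compat; lra. }
    pose proof (exp_pos (- (eta / 2) * t)). nra. }
  (* t (P - p t) is the integral of t e^(w s) over s > t. Replacing the factor t by s bounds it by
     the tail Jl - J (exp t). *)
  assert (Lt : is_lim (fun t => t * (P - p t)) p_infty 0).
  { apply is_lim_le_le_loc with (fun _ => 0) (fun t => Jl - J (exp t)).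
    - exists T. intros t Ht. split; [apply Rmult_le_pos; [lra | specialize (Hp t); lra]|].
      assert (P <= p t + (Jl - J (exp t)) / t).
      { apply (lim_le p P _ t Lp). intros s Hs.
        assert (H1 : t * p s - t * p t <= J (exp s) - J (exp t)).
        { apply (le_pos (fun s => t * p s - t * p t) (fun s => J (exp s) - J (exp t))
            (fun s => t * exp (w s)) (fun s => s * exp (w s)) t s); auto; try lra.
          - intros x _. D. ring.
          - intros x _. eapply D_eq; [apply D_minus; [apply is_derive_Jexp | apply D_const]|].
            ring.
          - intros x Hx. apply Rmult_le_compat_r; [left; apply exp_pos | lra]. }
        assert (H2 : T <= s) by lra. pose proof (HJl s H2) as H3.
        apply Rmult_le_reg_l with t; [lra|].
        replace (t * (p t + (Jl - J (exp t)) / t)) with (t * p t + (Jl - J (exp t)))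
          by (field; lra).
        cbv beta in H3. lra. }
      apply Rmult_le_compat_l with (r := t) in H0; [|lra].
      replace (t * (p t + (Jl - J (exp t)) / t)) with (t * p t + (Jl - J (exp t))) in H0
        by (field; lra).
      lra.
    - apply lim_const.
    - eapply lim_val; [apply lim_minus; [apply lim_const | apply LJ] | ring]. }
  exists (2 * PI ^ 2 * Jl). split.
  - exists Jl. split; [|reflexivity].
    apply (is_RInt_gen_half _ J).
    + intros r Hr.
      replace (J r) with (J r - J 0) by (rewrite J_0; ring).
      assert (Ef : forall x, 0 < x -> exp (u x) * pw x alpha * ln x * x ^ 3
                     = pw x (3 + alpha) * exp (u x) * ln x).
      { intros x Hx. replace (3 + alpha) with (alpha + 3) by ring.
        rewrite <- (pw_add x alpha) by assumption.
        replace (pw x 3) with (x ^ 3)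
          by (rewrite <- pw_nat by assumption; f_equal; simpl; ring).
        ring. }
      apply (FTC_half J); auto.
      (* Near 0, e^u <= 1 and |ln r| <= 1 / r, so the integrand is at most r^(2+alpha). *)
      * apply (hcont_squeeze _ 1 (2 + alpha)); [lra| | |].
        -- simpl; ring.
        -- intros x Hx.
           apply continuous_ext_loc with (fun x => pw x (3 + alpha) * exp (u x) * ln x).
           { apply filter_imp with (2 := locally_pos x Hx). intros; symmetry; now apply Ef. }
           apply (continuous_mult (fun x => pw x (3 + alpha) * exp (u x)) ln);
             [|now apply continuous_ln].
           apply (hcont_continuous (fun x => pw x (3 + alpha) * exp (u x))); [|assumption].
           hcont_tac.
        -- intros x Hx. rewrite Ef by lra. rewrite !Rabs_mult.
           rewrite (Rabs_pos_eq (pw x _)) by apply pw_ge0.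
           rewrite (Rabs_pos_eq (exp _)) by (left; apply exp_pos).
           assert (Hx0 : 0 <= x) by lra.
           assert (E1 : exp (u x) <= 1).
           { rewrite <- exp_0. apply exp_le_exp.
             now apply (rsys_u_nonpos _ _ _ _ _ _ _ H34 Ha sys). }
           pose proof (abs_ln_le x Hx) as E2. pose proof (pw_ge0 x (3 + alpha)) as E3.
           apply Rle_trans with (pw x (3 + alpha) * 1 * pw x (-1)).
           { apply Rmult_le_compat; [|apply Rabs_pos | | assumption].
             - apply Rmult_le_pos; [assumption | left; apply exp_pos].
             - now apply Rmult_le_compat_l. }
           right. rewrite Rmult_1_r, Rmult_1_l, pw_add by lra. f_equal; ring.
      * intros x Hx. rewrite Ef by assumption. now apply is_derive_J.
    + apply is_lim_ext_loc with (fun r => (fun t => J (exp t)) (ln r)).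
      * exists 0. intros r Hr. now rewrite exp_ln.
      * apply (lim_comp_ln (fun t => J (exp t))). exact LJ.
  (* [J_eq] solved for u, using 4 (8 + 2 alpha) = 8 (4 + alpha) = P. In the limit 2 y - z and t (P -
     p) drop out, leaving Jl / 4. *)
  - apply is_lim_ext_loc with
      (fun r => (fun t => / 4 * (J (exp t) + (2 * y t - z t) + t * (P - p t))) (ln r)).
    + exists 0. intros r Hr. cbv beta. rewrite J_eq, HP8.
      unfold w, efw. rewrite exp_ln by assumption. field.
    + apply (lim_comp_ln (fun t => / 4 * (J (exp t) + (2 * y t - z t) + t * (P - p t)))).
      eapply lim_val; [lim_tac|]. pose proof PI_RGT_0. field. lra.
Qed.

End Dim4.

(** * The three ranges of dimensions combined *)

Theorem theorem1p3 (N : nat) (alpha : R) :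
  (3 <= N)%nat -> -2 < alpha ->
  forall beta0 : R, is_lub (fun beta => entire N alpha beta) beta0 ->
  forall u v : R -> R, radial_sol N alpha beta0 p_infty u v ->
  (N = 3%nat ->
     exists I0 I1 I2 : R,
       is_radial_integral3 (fun r => pw r alpha * exp (u r)) I0 /\
       is_radial_integral3 (fun r => pw r (1 + alpha) * exp (u r)) I1 /\
       is_radial_integral3 (fun r => pw r (2 + alpha) * exp (u r)) I2 /\
       let a1 := - / (8 * PI) * I0 in
       let a2 := / (8 * PI) * I1 in
       let a3 := - / (24 * PI) * I2 in
       exists c : R, 0 < c /\
         exists C M : R, forall r, M <= r ->
           Rabs (u r - (a1 * r + a2 + a3 / r)) <= C * exp (- c * r)) /\
  (N = 4%nat ->
     exists I : R,
       is_radial_integral4 (fun r => exp (u r) * pw r alpha * ln r) I /\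
       is_lim (fun r => u r + (8 + 2 * alpha) * ln r) p_infty
              (Finite (/ (8 * PI ^ 2) * I))) /\
  ((5 <= N)%nat ->
     is_lim (fun r => u r + (4 + alpha) * ln r) p_infty
            (Finite (ln (2 * (4 + alpha) * (INR N - 2) * (INR N - 4))))).
Proof.
  intros HN Ha beta0 Hlub u v Hsol.
  pose proof (radial_sol_rsys N alpha beta0 u v HN Ha Hsol) as sys.
  pose proof (critical_v_lim N alpha beta0 u v _ _ HN Ha Hlub sys) as Hv.
  split; [|split].
  - intros ->. replace (INR 3) with 3 in sys by (simpl; ring).
    exact (critical_expansion_3 alpha beta0 u v _ _ Ha sys Hv).
  - intros ->. replace (INR 4) with 4 in sys by (simpl; ring).
    exact (critical_lim_4 alpha beta0 u v _ _ Ha sys Hv).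
  - intros H5. apply (critical_lim_ge5 (INR N) alpha beta0 u v _ _) with (4 := Hv) (3 := sys); auto.
    apply le_INR in H5. simpl in H5. lra.
Qed.
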